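(* Let $\mathfrak C$ be a finitely complete category and let $\Phi\colon\mathcal H\to\mathcal K$ be an internal functor between internal categories in $\mathfrak C$ which is fully faithful and such that $\Phi_0\colon H_0\to K_0$ is an effective descent morphism in $\mathfrak C$. Then pullback along $\Phi$ induces an equivalence $\mathbf{doFib}(\mathcal H)\simeq\mathbf{doFib}(\mathcal K)$ between the categories of internal discrete opfibrations over $\mathcal H$ and over $\mathcal K$.
   Context: An internal functor $\Phi\colon\mathcal H\to\mathcal K$ is fully faithful if the square with top $\Phi_1\colon H_1\to K_1$, sides $(s,t)\colon H_1\to H_0\times H_0$ and $(s,t)\colon K_1\to K_0\times K_0$, bottom $\Phi_0\times\Phi_0$ is a pullback. An internal functor $p\colon\mathcal X\to\mathcal K$ is a discrete opfibration if the square formed by $s\colon X_1\to X_0$, $p_1$, $p_0$, $s\colon K_1\to K_0$ is a pullback. A morphism $f\colon X\to Y$ of $\mathfrak C$ is an effective descent morphism if pullback along $f$ induces an equivalence between discrete opfibrations over $Y$ (as a discrete internal category) and discrete opfibrations over the internal groupoid given by the kernel pair of $f$. $\mathbf{doFib}(\mathcal K)$ has as morphisms internal functors over $\mathcal K$ between the domains. *)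

(* Defs.v *)
From Stdlib Require Import ProofIrrelevance.
Set Implicit Arguments.
Unset Strict Implicit.

Record Category := {
  Obj :> Type;
  Hom : Obj -> Obj -> Type;
  idm : forall A, Hom A A;
  comp : forall A B C, Hom B C -> Hom A B -> Hom A C;
  comp_assoc : forall A B C D (h : Hom C D) (g : Hom B C) (f : Hom A B),
      comp h (comp g f) = comp (comp h g) f;
  comp_id_l : forall A B (f : Hom A B), comp (idm B) f = f;
  comp_id_r : forall A B (f : Hom A B), comp f (idm A) = f }.

Arguments Hom {c} _ _.
Arguments idm {c} A.
Arguments comp {c A B C} _ _.
Notation "g ⊚ f" := (comp g f) (at level 40, left associativity).

Definition is_pullback (C : Category) (A B Z P : C)
  (f : Hom A Z) (g : Hom B Z) (p : Hom P A) (q : Hom P B) : Prop :=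
  f ⊚ p = g ⊚ q /\
  forall (X : C) (a : Hom X A) (b : Hom X B), f ⊚ a = g ⊚ b ->
    exists! u : Hom X P, p ⊚ u = a /\ q ⊚ u = b.

Record Terminal (C : Category) := {
  term_obj : C;
  term_map : forall X : C, Hom X term_obj;
  term_unique : forall (X : C) (u v : Hom X term_obj), u = v }.

Record Product (C : Category) (A B : C) := {
  prod_obj : C;
  pr1 : Hom prod_obj A;
  pr2 : Hom prod_obj B;
  pairing : forall X : C, Hom X A -> Hom X B -> Hom X prod_obj;
  pairing_pr1 : forall X (a : Hom X A) (b : Hom X B), pr1 ⊚ pairing a b = a;
  pairing_pr2 : forall X (a : Hom X A) (b : Hom X B), pr2 ⊚ pairing a b = b;
  pairing_unique : forall X (u v : Hom X prod_obj),
      pr1 ⊚ u = pr1 ⊚ v -> pr2 ⊚ u = pr2 ⊚ v -> u = v }.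

Record Pullback (C : Category) (A B Z : C) (f : Hom A Z) (g : Hom B Z) := {
  pb_obj : C;
  pb_p1 : Hom pb_obj A;
  pb_p2 : Hom pb_obj B;
  pb_sq : f ⊚ pb_p1 = g ⊚ pb_p2;
  pb_pair : forall (X : C) (a : Hom X A) (b : Hom X B), f ⊚ a = g ⊚ b -> Hom X pb_obj;
  pb_pair_p1 : forall X a b (e : f ⊚ a = g ⊚ b), pb_p1 ⊚ @pb_pair X a b e = a;
  pb_pair_p2 : forall X a b (e : f ⊚ a = g ⊚ b), pb_p2 ⊚ @pb_pair X a b e = b;
  pb_unique : forall X (u v : Hom X pb_obj),
      pb_p1 ⊚ u = pb_p1 ⊚ v -> pb_p2 ⊚ u = pb_p2 ⊚ v -> u = v }.

Record FinComplete (C : Category) := {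
  fc_terminal : Terminal C;
  fc_prod : forall A B : C, Product A B;
  fc_pb : forall (A B Z : C) (f : Hom A Z) (g : Hom B Z), Pullback f g }.

Section Internal.
Variable C : Category.

(** An internal category.  [P] is the object of composable pairs
    (pb_1, pb_2) with [tgt ∘ pb_1 = src ∘ pb_2] (first arrow, then second),
    and [mult] is composition.  The axioms are stated on generalized
    elements. *)
Record ICat := {
  C0 : C; C1 : C;
  src : Hom C1 C0; tgt : Hom C1 C0; unit : Hom C0 C1;
  P : C; p1 : Hom P C1; p2 : Hom P C1;
  P_pb : is_pullback tgt src p1 p2;
  mult : Hom P C1;
  src_unit : src ⊚ unit = idm C0;
  tgt_unit : tgt ⊚ unit = idm C0;
  src_mult : src ⊚ mult = src ⊚ p1;
  tgt_mult : tgt ⊚ mult = tgt ⊚ p2;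
  mult_unit_l : forall (X : C) (f : Hom X C1) (u : Hom X P),
      p1 ⊚ u = unit ⊚ src ⊚ f -> p2 ⊚ u = f -> mult ⊚ u = f;
  mult_unit_r : forall (X : C) (f : Hom X C1) (u : Hom X P),
      p1 ⊚ u = f -> p2 ⊚ u = unit ⊚ tgt ⊚ f -> mult ⊚ u = f;
  mult_assoc : forall (X : C) (u v w z : Hom X P),
      p2 ⊚ u = p1 ⊚ v ->
      p1 ⊚ w = mult ⊚ u -> p2 ⊚ w = p2 ⊚ v ->
      p1 ⊚ z = p1 ⊚ u -> p2 ⊚ z = mult ⊚ v ->
      mult ⊚ w = mult ⊚ z }.

Record IFun (H K : ICat) := {
  F0 : Hom (C0 H) (C0 K);
  F1 : Hom (C1 H) (C1 K);
  F_src : src K ⊚ F1 = F0 ⊚ src H;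
  F_tgt : tgt K ⊚ F1 = F0 ⊚ tgt H;
  F_unit : F1 ⊚ unit H = unit K ⊚ F0;
  F_mult : forall (X : C) (u : Hom X (P H)) (v : Hom X (P K)),
      p1 K ⊚ v = F1 ⊚ p1 H ⊚ u -> p2 K ⊚ v = F1 ⊚ p2 H ⊚ u ->
      F1 ⊚ mult H ⊚ u = mult K ⊚ v }.

Lemma IFun_eq (H K : ICat) (F G : IFun H K) :
  F0 F = F0 G -> F1 F = F1 G -> F = G.
Proof.
  destruct F as [a b c d e f], G as [a' b' c' d' e' f']; simpl; intros -> ->.
  f_equal; apply proof_irrelevance.
Qed.

Definition IFun_id_def (H : ICat) : IFun H H.
Proof.
  refine {| F0 := idm (C0 H); F1 := idm (C1 H) |}.
  - rewrite comp_id_l, comp_id_r; reflexivity.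
  - rewrite comp_id_l, comp_id_r; reflexivity.
  - rewrite comp_id_l, comp_id_r; reflexivity.
  - intros X u v e1 e2. rewrite !comp_id_l in *.
    assert (u = v) as ->.
    { destruct (P_pb H) as [_ HP].
      assert (E : tgt H ⊚ (p1 H ⊚ u) = src H ⊚ (p2 H ⊚ u)).
      { rewrite !comp_assoc, (proj1 (P_pb H)); reflexivity. }
      destruct (HP X _ _ E) as [w [_ Hw]].
      transitivity w; [symmetry; apply Hw; split; reflexivity|].
      apply Hw; split; assumption. }
    reflexivity.
Defined.

Definition IFun_comp_def (H K L : ICat) (G : IFun K L) (F : IFun H K) : IFun H L.
Proof.
  refine {| F0 := F0 G ⊚ F0 F; F1 := F1 G ⊚ F1 F |}.
  - rewrite comp_assoc, F_src, <- comp_assoc, F_src, comp_assoc; reflexivity.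
  - rewrite comp_assoc, F_tgt, <- comp_assoc, F_tgt, comp_assoc; reflexivity.
  - rewrite <- comp_assoc, F_unit, comp_assoc, F_unit, comp_assoc; reflexivity.
  - intros X u w e1 e2.
    assert (E : tgt K ⊚ (F1 F ⊚ p1 H ⊚ u) = src K ⊚ (F1 F ⊚ p2 H ⊚ u)).
    { rewrite !comp_assoc, F_tgt, F_src, <- !(comp_assoc (F0 F)),
        (proj1 (P_pb H)); reflexivity. }
    destruct (proj2 (P_pb K) X _ _ E) as [v [[ev1 ev2] _]].
    rewrite <- (comp_assoc (F1 G)), <- (comp_assoc (F1 G)).
    rewrite (@F_mult _ _ F X u v ev1 ev2).
    rewrite comp_assoc.
    apply F_mult.
    + rewrite e1, <- (comp_assoc (F1 G) (p1 K)), ev1, !comp_assoc; reflexivity.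
    + rewrite e2, <- (comp_assoc (F1 G) (p2 K)), ev2, !comp_assoc; reflexivity.
Defined.

Definition CatC : Category.
Proof.
  refine {| Obj := ICat; Hom := IFun; idm := IFun_id_def;
            comp := fun A B D G F => IFun_comp_def G F |}.
  - intros; apply IFun_eq; simpl; apply comp_assoc.
  - intros; apply IFun_eq; simpl; apply comp_id_l.
  - intros; apply IFun_eq; simpl; apply comp_id_r.
Defined.

Definition is_dofib (X K : ICat) (p : IFun X K) : Prop :=
  is_pullback (F0 p) (src K) (src X) (F1 p).

Definition fully_faithful (FC : FinComplete C) (H K : ICat) (Phi : IFun H K) : Prop :=
  let PH := fc_prod FC (C0 H) (C0 H) in
  let PK := fc_prod FC (C0 K) (C0 K) in
  let stH : Hom (C1 H) (prod_obj PH) := pairing PH (src H) (tgt H) in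
  let stK : Hom (C1 K) (prod_obj PK) := pairing PK (src K) (tgt K) in
  let Phi00 : Hom (prod_obj PH) (prod_obj PK) :=
      pairing PK (F0 Phi ⊚ pr1 PH) (F0 Phi ⊚ pr2 PH) in
  is_pullback stK Phi00 (F1 Phi) stH.

End Internal.

Arguments ICat C : clear implicits.

Record Functor (C D : Category) := {
  fobj :> C -> D;
  fmap : forall A B : C, Hom A B -> Hom (fobj A) (fobj B);
  fmap_id : forall A : C, fmap (idm A) = idm (fobj A);
  fmap_comp : forall (A B E : C) (g : Hom B E) (f : Hom A B),
      fmap (g ⊚ f) = fmap g ⊚ fmap f }.
Arguments fmap {C D} F {A B} _ : rename.

Record NatIso (C D : Category) (F G : Functor C D) := {
  ni_map : forall A : C, Hom (F A) (G A);
  ni_inv : forall A : C, Hom (G A) (F A);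
  ni_inv_l : forall A, ni_inv A ⊚ ni_map A = idm (F A);
  ni_inv_r : forall A, ni_map A ⊚ ni_inv A = idm (G A);
  ni_natural : forall (A B : C) (f : Hom A B),
      ni_map B ⊚ fmap F f = fmap G f ⊚ ni_map A }.

Definition Functor_id (C : Category) : Functor C C.
Proof.
  refine {| fobj := fun A => A; fmap := fun A B f => f |}; reflexivity.
Defined.

Definition Functor_comp (C D E : Category) (G : Functor D E) (F : Functor C D)
  : Functor C E.
Proof.
  refine {| fobj := fun A => G (F A); fmap := fun A B f => fmap G (fmap F f) |}.
  - intros; rewrite !fmap_id; reflexivity.
  - intros; rewrite !fmap_comp; reflexivity.
Defined.

Definition is_equivalence (C D : Category) (F : Functor C D) : Prop :=
  exists G : Functor D C,
    inhabited (NatIso (Functor_comp G F) (Functor_id C)) /\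
    inhabited (NatIso (Functor_comp F G) (Functor_id D)).

Section DoFib.
Variable C : Category.

Record DOF (K : ICat C) := {
  dof_dom : ICat C;
  dof_proj : IFun dof_dom K;
  dof_is : is_dofib dof_proj }.

Definition DOF_hom (K : ICat C) (a b : DOF K) :=
  { F : IFun (dof_dom a) (dof_dom b) |
    @comp (CatC C) _ _ _ (dof_proj b) F = dof_proj a }.

Lemma DOF_hom_eq (K : ICat C) (a b : DOF K) (F G : DOF_hom a b) :
  proj1_sig F = proj1_sig G -> F = G.
Proof.
  destruct F as [F hF], G as [G hG]; simpl; intros ->.
  f_equal; apply proof_irrelevance.
Qed.

Definition DOF_id (K : ICat C) (a : DOF K) : DOF_hom a a :=
  exist _ (@idm (CatC C) (dof_dom a)) (@comp_id_r (CatC C) _ _ (dof_proj a)).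

Definition DOF_comp (K : ICat C) (a b c : DOF K) (G : DOF_hom b c) (F : DOF_hom a b)
  : DOF_hom a c.
Proof.
  refine (exist _ (@comp (CatC C) _ _ _ (proj1_sig G) (proj1_sig F)) _).
  rewrite (@comp_assoc (CatC C)), (proj2_sig G), (proj2_sig F); reflexivity.
Defined.

Definition doFib (K : ICat C) : Category.
Proof.
  refine {| Obj := DOF K; Hom := @DOF_hom K; idm := @DOF_id K; comp := @DOF_comp K |}.
  - intros; apply DOF_hom_eq; simpl; apply (@comp_assoc (CatC C)).
  - intros; apply DOF_hom_eq; simpl; apply (@comp_id_l (CatC C)).
  - intros; apply DOF_hom_eq; simpl; apply (@comp_id_r (CatC C)).
Defined.

Definition is_pullback_functor (H K : ICat C) (Phi : IFun H K)
  (G : Functor (doFib K) (doFib H))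
  (pi : forall p : DOF K, IFun (dof_dom (G p)) (dof_dom p)) : Prop :=
  (forall p : DOF K,
      @is_pullback (CatC C) _ _ _ _ (dof_proj p) Phi (pi p) (dof_proj (G p))) /\
  (forall (p q : DOF K) (f : DOF_hom p q),
      @comp (CatC C) _ _ _ (pi q) (proj1_sig (fmap G f)) =
      @comp (CatC C) _ _ _ (proj1_sig f) (pi p)).

Definition pullback_is_equivalence (H K : ICat C) (Phi : IFun H K) : Prop :=
  (exists G pi, @is_pullback_functor H K Phi G pi) /\
  (forall G pi, @is_pullback_functor H K Phi G pi -> is_equivalence G).

End DoFib.

Section Descent.
Variable C : Category.

Lemma is_pullback_id_id (Y : C) : is_pullback (idm Y) (idm Y) (idm Y) (idm Y).
Proof.
  split; [reflexivity|].
  intros X a b e; rewrite !comp_id_l in e; subst b.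
  exists a; split; [rewrite !comp_id_l; split; reflexivity|].
  intros u [e1 _]; rewrite comp_id_l in e1; symmetry; exact e1.
Qed.

Definition disc (Y : C) : ICat C.
Proof.
  refine {| C0 := Y; C1 := Y; src := idm Y; tgt := idm Y; unit := idm Y;
            P := Y; p1 := idm Y; p2 := idm Y; P_pb := is_pullback_id_id Y;
            mult := idm Y |};
  intros; repeat rewrite comp_id_l in *; repeat rewrite comp_id_r in *;
  try reflexivity; try assumption.
  congruence.
Defined.

Lemma pb_is_pullback (A B Z : C) (f : Hom A Z) (g : Hom B Z) (Q : Pullback f g) :
  is_pullback f g (pb_p1 Q) (pb_p2 Q).
Proof.
  split; [apply pb_sq|].
  intros X a b e; exists (pb_pair Q e); split.
  - split; [apply pb_pair_p1 | apply pb_pair_p2].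
  - intros u [e1 e2]; apply pb_unique;
      [rewrite pb_pair_p1 | rewrite pb_pair_p2]; symmetry; assumption.
Qed.

Section KP.
Variable FC : FinComplete C.
Variables X Y : C.
Variable f : Hom X Y.

Let KQ := fc_pb FC f f.
Let K := pb_obj KQ.
Let k1 : Hom K X := pb_p1 KQ.
Let k2 : Hom K X := pb_p2 KQ.
Let PQ := fc_pb FC k2 k1.
Let q1 : Hom (pb_obj PQ) K := pb_p1 PQ.
Let q2 : Hom (pb_obj PQ) K := pb_p2 PQ.

Lemma kp_unit_eq : f ⊚ idm X = f ⊚ idm X.
Proof. reflexivity. Qed.

Lemma kp_mult_eq : f ⊚ (k1 ⊚ q1) = f ⊚ (k2 ⊚ q2).
Proof.
  assert (s1 : f ⊚ k1 = f ⊚ k2) by apply (pb_sq KQ).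
  assert (s2 : k2 ⊚ q1 = k1 ⊚ q2) by apply (pb_sq PQ).
  rewrite !comp_assoc, s1, <- !comp_assoc, s2, !comp_assoc, s1; reflexivity.
Qed.

Lemma K_ext (Z : C) (u v : Hom Z K) : k1 ⊚ u = k1 ⊚ v -> k2 ⊚ u = k2 ⊚ v -> u = v.
Proof. apply pb_unique. Qed.

Definition kp_unit : Hom X K := pb_pair KQ kp_unit_eq.
Definition kp_mult : Hom (pb_obj PQ) K := pb_pair KQ kp_mult_eq.

Lemma k1_unit : k1 ⊚ kp_unit = idm X.
Proof. apply (pb_pair_p1 KQ). Qed.
Lemma k2_unit : k2 ⊚ kp_unit = idm X.
Proof. apply (pb_pair_p2 KQ). Qed.
Lemma k1_mult : k1 ⊚ kp_mult = k1 ⊚ q1.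
Proof. apply (pb_pair_p1 KQ). Qed.
Lemma k2_mult : k2 ⊚ kp_mult = k2 ⊚ q2.
Proof. apply (pb_pair_p2 KQ). Qed.

Definition kp_cat : ICat C.
Proof.
  refine {| C0 := X; C1 := K; src := k1; tgt := k2;
            unit := kp_unit;
            P := pb_obj PQ; p1 := q1; p2 := q2; P_pb := pb_is_pullback PQ;
            mult := kp_mult |}.
  - apply k1_unit.
  - apply k2_unit.
  - apply k1_mult.
  - apply k2_mult.
  - intros Z g u e1 e2. apply K_ext.
    + rewrite comp_assoc, k1_mult, <- comp_assoc, e1, <- !comp_assoc.
      rewrite (comp_assoc k1), k1_unit, comp_id_l; reflexivity.
    + rewrite comp_assoc, k2_mult, <- comp_assoc, e2; reflexivity.
  - intros Z g u e1 e2. apply K_ext.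
    + rewrite comp_assoc, k1_mult, <- comp_assoc, e1; reflexivity.
    + rewrite comp_assoc, k2_mult, <- comp_assoc, e2, <- !comp_assoc.
      rewrite (comp_assoc k2), k2_unit, comp_id_l; reflexivity.
  - intros Z u v w z e0 e1 e2 e3 e4. apply K_ext.
    + rewrite !comp_assoc, !k1_mult, <- !comp_assoc, e1, e3, comp_assoc, k1_mult,
        <- comp_assoc; reflexivity.
    + rewrite !comp_assoc, !k2_mult, <- !comp_assoc, e2, e4, (comp_assoc k2 kp_mult), k2_mult,
        <- comp_assoc; reflexivity.
Defined.

Definition kp_fun : IFun kp_cat (disc Y).
Proof.
  refine {| F0 := f : Hom (C0 kp_cat) (C0 (disc Y));
            F1 := (f ⊚ k1) : Hom (C1 kp_cat) (C1 (disc Y)) |}; simpl.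
  - rewrite comp_id_l; reflexivity.
  - rewrite comp_id_l; apply (pb_sq KQ).
  - rewrite comp_id_l, <- comp_assoc, k1_unit, comp_id_r; reflexivity.
  - intros Z u v e1 e2. rewrite comp_id_l in e1 |- *.
    rewrite e1, <- (comp_assoc f k1 kp_mult), k1_mult, comp_assoc; reflexivity.
Defined.

End KP.

Definition effective_descent (FC : FinComplete C) (X Y : C) (f : Hom X Y) : Prop :=
  pullback_is_equivalence (kp_fun FC f).

End Descent.

(* Main.v *)
Require Import Defs.
From Stdlib Require Import IndefiniteDescription.
Set Implicit Arguments.
Unset Strict Implicit.

(** Write [f = F0 Phi]. Full faithfulness of pullback along [f] makes every pullback
    of [f] a coequalizer of its kernel pair, so equalities and morphisms can be
    constructed locally. Since [Phi] is fully faithful, two points of [C0 H] with the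
    same image under [f] are joined by a unique arrow over an identity, a vertical
    arrow; hence the kernel pair groupoid of [f] maps to [H], and a discrete opfibration
    [A] over [H] restricts to a descent datum on [C0 A], which yields [B0] over [C0 K]
    with [C0 A] its pullback along [f]. Two lifts to [A] of an arrow of [K] with the same
    source in [B0] differ by vertical arrows, which are collapsed in [B0]; so the action
    of [H] on [C0 A] descends locally, hence globally, to an action of [K] on [B0].
    Fullness of the pullback functor is obtained in the same way. *)

(** * Rewriting composites modulo associativity *)

Lemma comp_post (C : Category) (A B D : C) (g : Hom B D) (f : Hom A B) (h : Hom A D) :
  g ⊚ f = h -> forall (X : C) (x : Hom X A), g ⊚ (f ⊚ x) = h ⊚ x.
Proof. intros e X x; rewrite comp_assoc, e; reflexivity. Qed.

Lemma comp_post2 (C : Category) (A B D E : C) (g : Hom D E) (f : Hom B D) (f' : Hom A B)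
  (h : Hom A E) :
  g ⊚ (f ⊚ f') = h -> forall (X : C) (x : Hom X A), g ⊚ (f ⊚ (f' ⊚ x)) = h ⊚ x.
Proof. intros e X x; rewrite <- e, !comp_assoc; reflexivity. Qed.

Ltac nf := rewrite <- ?comp_assoc, ?comp_id_l, ?comp_id_r.
(** Composites are kept right nested, where the left side of [e] may be followed by a further
    factor; hence the three forms of the rewrite. *)
Ltac rw e := nf; first [rewrite (comp_post2 e) | rewrite (comp_post e) | rewrite e]; nf.
Ltac rwl e := rw (eq_sym e).

(** * Equivalences as fully faithful, essentially surjective functors *)

Section Equivalences.
Variables (C D : Category) (F : Functor C D).

Definition fully_faithful_functor : Prop :=
  forall (A B : C) (g : Hom (F A) (F B)), exists! f : Hom A B, fmap F f = g.

Definition essentially_surjective : Prop :=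
  forall Y : D, exists (A : C) (i : Hom (F A) Y) (j : Hom Y (F A)),
    j ⊚ i = idm (F A) /\ i ⊚ j = idm Y.

(** Objects and arrows of the inverse are obtained by choice, the arrows as preimages of conjugates
    by the chosen isomorphisms. Faithfulness turns each law of the inverse into an equation in
    [D]. *)
Lemma ff_es_equivalence :
  fully_faithful_functor -> essentially_surjective -> is_equivalence F.
Proof.
  intros ff es.
  assert (inj : forall A B (f g : Hom A B), fmap F f = fmap F g -> f = g).
  { intros A B f g e; destruct (ff A B (fmap F f)) as [h [_ hu]].
    rewrite <- (hu f eq_refl); apply hu; symmetry; exact e. }
  pose (pre := fun A B g => constructive_indefinite_description _ (ff A B g)).
  assert (fpre : forall A B g, fmap F (proj1_sig (pre A B g)) = g)
    by (intros A B g; exact (proj1 (proj2_sig (pre A B g)))).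
  pose (ob := fun Y => constructive_indefinite_description _ (es Y)).
  pose (i := fun Y => constructive_indefinite_description _ (proj2_sig (ob Y))).
  pose (j := fun Y => constructive_indefinite_description _ (proj2_sig (i Y))).
  assert (ji : forall Y, proj1_sig (j Y) ⊚ proj1_sig (i Y) = idm _)
    by (intro Y; exact (proj1 (proj2_sig (j Y)))).
  assert (ij : forall Y, proj1_sig (i Y) ⊚ proj1_sig (j Y) = idm _)
    by (intro Y; exact (proj2 (proj2_sig (j Y)))).
  unshelve refine (let G : Functor D C :=
    {| fobj := fun Y => proj1_sig (ob Y);
       fmap := fun Y Z g => proj1_sig (pre (proj1_sig (ob Y)) (proj1_sig (ob Z))
                 (proj1_sig (j Z) ⊚ g ⊚ proj1_sig (i Y))) |} in _).
  { intro Y; apply inj; rewrite fpre, fmap_id; nf; apply ji. }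
  { intros Y Z W g h; apply inj; rewrite fmap_comp, !fpre.
    nf; rw (ij Z); reflexivity. }
  exists G; split; constructor.
  - refine (@Build_NatIso _ _ (Functor_comp G F) (Functor_id C)
      (fun A => proj1_sig (pre (proj1_sig (ob (F A))) A (proj1_sig (i (F A)))))
      (fun A => proj1_sig (pre A (proj1_sig (ob (F A))) (proj1_sig (j (F A))))) _ _ _).
    + intro A; apply inj; simpl; rewrite fmap_comp, !fpre, fmap_id; apply ji.
    + intro A; apply inj; simpl; rewrite fmap_comp, !fpre, fmap_id; apply ij.
    + intros A B f; simpl; apply inj; rewrite !fmap_comp, !fpre.
      nf; rw (ij (F B)); reflexivity.
  - refine (@Build_NatIso _ _ (Functor_comp F G) (Functor_id D)
      (fun Y => proj1_sig (i Y)) (fun Y => proj1_sig (j Y)) ji ij _).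
    intros Y Z g; simpl; rewrite fpre; nf; rw (ij Z); reflexivity.
Qed.

Lemma equivalence_fully_faithful : is_equivalence F -> fully_faithful_functor.
Proof.
  intros [G [[n] [m]]].
  assert (inj : forall A B (f g : Hom A B), fmap F f = fmap F g -> f = g).
  { intros A B f g e.
    pose proof (ni_natural n f) as nf0; pose proof (ni_natural n g) as ng0.
    simpl in nf0, ng0; rewrite e, ng0 in nf0.
    pose proof (ni_inv_r n A) as r; simpl in r.
    rewrite <- (comp_id_r f), <- (comp_id_r g), <- r.
    rewrite !comp_assoc, nf0; reflexivity. }
  assert (injG : forall A B (f g : Hom A B), fmap G f = fmap G g -> f = g).
  { intros A B f g e.
    pose proof (ni_natural m f) as nf0; pose proof (ni_natural m g) as ng0.
    simpl in nf0, ng0; rewrite e, ng0 in nf0.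
    pose proof (ni_inv_r m A) as r; simpl in r.
    rewrite <- (comp_id_r f), <- (comp_id_r g), <- r.
    rewrite !comp_assoc, nf0; reflexivity. }
  intros A B g.
  (* Naturality of [n] forces this witness. That [F] sends it to [g] is verified after applying the
     faithful functor [G]. *)
  exists (ni_map n B ⊚ fmap G g ⊚ ni_inv n A); split.
  - apply injG.
    pose proof (ni_natural n (ni_map n B ⊚ fmap G g ⊚ ni_inv n A)) as e.
    pose proof (ni_inv_l n A) as rA; pose proof (ni_inv_l n B) as rB.
    simpl in e, rA, rB; rewrite <- !comp_assoc, rA, comp_id_r in e.
    apply (f_equal (fun x => ni_inv n B ⊚ x)) in e; simpl in e.
    rewrite !comp_assoc, !rB, !comp_id_l in e; exact e.
  - intros h <-; pose proof (ni_natural n h) as e; pose proof (ni_inv_r n A) as r.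
    simpl in e, r |- *; rewrite e, <- comp_assoc, r; apply comp_id_r.
Qed.

Lemma equivalence_essentially_surjective : is_equivalence F -> essentially_surjective.
Proof.
  intros [G [_ [m]]] Y.
  exists (G Y), (ni_map m Y), (ni_inv m Y); split; [exact (ni_inv_l m Y) | exact (ni_inv_r m Y)].
Qed.

End Equivalences.

(** * Pullbacks, epimorphisms and covers *)

Section Pullbacks.
Variable C : Category.

Lemma pullback_lift (A B Z Q : C) (f : Hom A Z) (g : Hom B Z) (p : Hom Q A) (q : Hom Q B) :
  is_pullback f g p q -> forall (X : C) (a : Hom X A) (b : Hom X B), f ⊚ a = g ⊚ b ->
  exists u, p ⊚ u = a /\ q ⊚ u = b.
Proof. intros [_ l] X a b e; destruct (l X a b e) as [u [hu _]]; exists u; exact hu. Qed.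

Lemma pullback_ext (A B Z Q : C) (f : Hom A Z) (g : Hom B Z) (p : Hom Q A) (q : Hom Q B) :
  is_pullback f g p q -> forall (X : C) (u v : Hom X Q),
  p ⊚ u = p ⊚ v -> q ⊚ u = q ⊚ v -> u = v.
Proof.
  intros [s l] X u v e1 e2.
  destruct (l X (p ⊚ v) (q ⊚ v)) as [w [_ hw]]; [rw s; reflexivity|].
  rewrite <- (hw u); [|split; assumption].
  apply hw; split; reflexivity.
Qed.

Lemma pullback_of_iso (A B Z Q R : C) (f : Hom A Z) (g : Hom B Z) (p : Hom Q A) (q : Hom Q B)
  (p' : Hom R A) (q' : Hom R B) (i : Hom R Q) (j : Hom Q R) :
  is_pullback f g p q -> p ⊚ i = p' -> q ⊚ i = q' -> i ⊚ j = idm Q -> j ⊚ i = idm R ->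
  is_pullback f g p' q'.
Proof.
  intros hp e1 e2 ij ji; split.
  - rewrite <- e1, <- e2; rw (proj1 hp); reflexivity.
  - intros X a b e; destruct (pullback_lift hp e) as [u [u1 u2]].
    exists (j ⊚ u); split.
    + split; rewrite <- ?e1, <- ?e2; rw ij; assumption.
    + intros v [v1 v2].
      assert (u = i ⊚ v) as ->.
      { apply (pullback_ext hp); rewrite comp_assoc, ?e1, ?e2, ?v1, ?v2; assumption. }
      rw ji; reflexivity.
Qed.

Lemma pullbacks_iso (A B Z Q R : C) (f : Hom A Z) (g : Hom B Z) (p : Hom Q A) (q : Hom Q B)
  (p' : Hom R A) (q' : Hom R B) :
  is_pullback f g p q -> is_pullback f g p' q' ->
  exists (i : Hom R Q) (j : Hom Q R),
    i ⊚ j = idm Q /\ j ⊚ i = idm R /\ p ⊚ i = p' /\ q ⊚ i = q' /\ p' ⊚ j = p /\ q' ⊚ j = q.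
Proof.
  intros h h'.
  destruct (pullback_lift h (proj1 h')) as [i [i1 i2]].
  destruct (pullback_lift h' (proj1 h)) as [j [j1 j2]].
  exists i, j; repeat split; try assumption.
  - apply (pullback_ext h); [rw i1 | rw i2]; assumption.
  - apply (pullback_ext h'); [rw j1 | rw j2]; assumption.
Qed.

Definition epi (A B : C) (e : Hom A B) : Prop :=
  forall (W : C) (u v : Hom B W), u ⊚ e = v ⊚ e -> u = v.

Lemma epi_comp (A B D : C) (e : Hom A B) (e' : Hom B D) : epi e -> epi e' -> epi (e' ⊚ e).
Proof. intros h h' W u v E; apply h', h; nf; exact E. Qed.

(* A regular epimorphism, with its kernel pair expressed on generalized elements. *)
Definition cover (A B : C) (e : Hom A B) : Prop :=
  forall (W : C) (h : Hom A W),
    (forall (T : C) (u v : Hom T A), e ⊚ u = e ⊚ v -> h ⊚ u = h ⊚ v) ->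
    exists! h' : Hom B W, h' ⊚ e = h.

Lemma cover_epi (A B : C) (e : Hom A B) : cover e -> epi e.
Proof.
  intros c W u v E; destruct (c W (v ⊚ e)) as [w [_ hw]].
  - intros T x y exy; nf; rewrite exy; reflexivity.
  - rewrite <- (hw u E); apply hw; reflexivity.
Qed.

Lemma cover_iso (A A' B : C) (e : Hom A B) (i : Hom A' A) (j : Hom A A') :
  i ⊚ j = idm A -> j ⊚ i = idm A' -> cover e -> cover (e ⊚ i).
Proof.
  intros ij ji c W h hh.
  destruct (c W (h ⊚ j)) as [w [hw wu]].
  - intros T u v E; nf; apply hh; nf; rw ij; rw ij; exact E.
  - exists w; split.
    + rw hw; rw ji; reflexivity.
    + intros w' hw'; apply wu; rewrite <- hw'; rw ij; reflexivity.
Qed.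

End Pullbacks.

(** * Unique lifting in internal discrete opfibrations *)

Section InternalFunctors.
Variable C : Category.

Lemma IFun_eq_F0 (H K : ICat C) (F G : IFun H K) : F = G -> F0 F = F0 G.
Proof. intros ->; reflexivity. Qed.

Lemma IFun_eq_F1 (H K : ICat C) (F G : IFun H K) : F = G -> F1 F = F1 G.
Proof. intros ->; reflexivity. Qed.

Lemma composable_lift (K : ICat C) (X : C) (k l : Hom X (C1 K)) :
  tgt K ⊚ k = src K ⊚ l -> exists u : Hom X (P K), p1 K ⊚ u = k /\ p2 K ⊚ u = l.
Proof. intro e; exact (pullback_lift (P_pb K) e). Qed.

Lemma functor_composable (H K : ICat C) (F : IFun H K) (X : C) (u : Hom X (P H)) :
  exists v : Hom X (P K), p1 K ⊚ v = F1 F ⊚ (p1 H ⊚ u) /\ p2 K ⊚ v = F1 F ⊚ (p2 H ⊚ u).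
Proof.
  apply composable_lift; rw (F_tgt F); rw (F_src F); rw (proj1 (P_pb H)); reflexivity.
Qed.

Lemma functor_mult (H K : ICat C) (F : IFun H K) (X : C) (u : Hom X (P H)) (v : Hom X (P K)) :
  p1 K ⊚ v = F1 F ⊚ (p1 H ⊚ u) -> p2 K ⊚ v = F1 F ⊚ (p2 H ⊚ u) ->
  F1 F ⊚ (mult H ⊚ u) = mult K ⊚ v.
Proof. rewrite !comp_assoc; apply F_mult. Qed.

Section DiscreteOpfibrations.
Variables (A K : ICat C) (p : IFun A K).
Hypothesis dp : is_dofib p.

Lemma dof_lift (X : C) (a : Hom X (C0 A)) (k : Hom X (C1 K)) :
  F0 p ⊚ a = src K ⊚ k -> exists z : Hom X (C1 A), src A ⊚ z = a /\ F1 p ⊚ z = k.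
Proof. exact (@pullback_lift _ _ _ _ _ _ _ _ _ dp X a k). Qed.

Lemma dof_ext (X : C) (u v : Hom X (C1 A)) :
  src A ⊚ u = src A ⊚ v -> F1 p ⊚ u = F1 p ⊚ v -> u = v.
Proof. exact (@pullback_ext _ _ _ _ _ _ _ _ _ dp X u v). Qed.

(** The identity at the source of [z] has the same source and the same image as [z], so uniqueness
    of lifts makes [z] that identity. *)
Lemma dof_over_unit (X : C) (z : Hom X (C1 A)) (x : Hom X (C0 K)) :
  F1 p ⊚ z = unit K ⊚ x -> tgt A ⊚ z = src A ⊚ z.
Proof.
  intro e.
  assert (ex : x = F0 p ⊚ (src A ⊚ z)).
  { rewrite <- (comp_id_l x), <- (src_unit K); nf; rewrite <- e; rw (F_src p); reflexivity. }
  assert (z = unit A ⊚ (src A ⊚ z)) as ->.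
  { apply dof_ext; [rw (src_unit A); reflexivity|].
    rw (F_unit p); rewrite e, ex; reflexivity. }
  rw (tgt_unit A); rw (src_unit A); reflexivity.
Qed.

Lemma dof_functor_ext (Z : ICat C) (F G : IFun Z A) :
  F0 F = F0 G -> @comp (CatC C) _ _ _ p F = @comp (CatC C) _ _ _ p G -> F = G.
Proof.
  intros e0 e; apply IFun_eq; [exact e0|].
  apply dof_ext.
  - rewrite !F_src, e0; reflexivity.
  - exact (IFun_eq_F1 e).
Qed.

(** Unique lifting forces the arrow part, and it also gives the unit and composition laws. Only
    compatibility with targets has to be assumed; it is stated for every lift [w], so that no arrow
    part needs to be named. *)
Lemma dof_functor_lift (Z : ICat C) (b : IFun Z K) (u0 : Hom (C0 Z) (C0 A)) :
  F0 p ⊚ u0 = F0 b ->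
  (forall (X : C) (z : Hom X (C1 Z)) (w : Hom X (C1 A)),
     src A ⊚ w = u0 ⊚ (src Z ⊚ z) -> F1 p ⊚ w = F1 b ⊚ z ->
     tgt A ⊚ w = u0 ⊚ (tgt Z ⊚ z)) ->
  exists F : IFun Z A, F0 F = u0 /\ @comp (CatC C) _ _ _ p F = b.
Proof.
  intros e0 ht.
  destruct (@dof_lift _ (u0 ⊚ src Z) (F1 b)) as [u1 [e1 e2]].
  { rw e0; rw (F_src b); reflexivity. }
  assert (e3 : tgt A ⊚ u1 = u0 ⊚ tgt Z).
  { pose proof (ht _ (idm _) u1) as h; revert h; nf; auto. }
  assert (eu : u1 ⊚ unit Z = unit A ⊚ u0).
  { apply dof_ext.
    - rw e1; rw (src_unit Z); rw (src_unit A); reflexivity.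
    - rw e2; rw (F_unit b); rw (F_unit p); rewrite e0; reflexivity. }
  assert (em : forall (X : C) (u : Hom X (P Z)) (v : Hom X (P A)),
    p1 A ⊚ v = u1 ⊚ p1 Z ⊚ u -> p2 A ⊚ v = u1 ⊚ p2 Z ⊚ u ->
    u1 ⊚ mult Z ⊚ u = mult A ⊚ v).
  { intros X u v h1 h2; rewrite <- comp_assoc in h1, h2 |- *; apply dof_ext.
    - rw e1; rw (src_mult Z); rw (src_mult A); rewrite h1; rw e1; reflexivity.
    - rw e2.
      destruct (functor_composable p v) as [w [w1 w2]].
      rewrite (functor_mult w1 w2).
      apply functor_mult; rewrite ?w1, ?w2, ?h1, ?h2; rw e2; reflexivity. }
  exists (Build_IFun e1 e3 eu em); split; [reflexivity|].
  apply IFun_eq; [exact e0 | exact e2].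
Qed.

End DiscreteOpfibrations.

Definition point (X : C) (A : ICat C) (a : Hom X (C0 A)) : IFun (disc X) A.
Proof.
  refine (@Build_IFun C (disc X) A a (unit A ⊚ a) _ _ _ _); simpl.
  - rw (src_unit A); reflexivity.
  - rw (tgt_unit A); reflexivity.
  - nf; reflexivity.
  - intros T u v; nf; intros e1 e2; symmetry; apply mult_unit_l.
    + rw (src_unit A); exact e1.
    + exact e2.
Defined.

(* The functor [C0] is represented by discrete internal categories, so it
   preserves pullbacks. *)
Lemma pullback_F0 (A B Z Q : ICat C) (f : IFun A Z) (g : IFun B Z) (p : IFun Q A)
  (q : IFun Q B) :
  @is_pullback (CatC C) A B Z Q f g p q -> is_pullback (F0 f) (F0 g) (F0 p) (F0 q).
Proof.
  intro h; split; [exact (IFun_eq_F0 (proj1 h))|].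
  intros X a b e.
  destruct (proj2 h (disc X) (point a) (point b)) as [u [[u1 u2] hu]].
  { apply IFun_eq; [exact e|]; simpl.
    rw (F_unit f); rw (F_unit g); rewrite e; reflexivity. }
  exists (F0 u); split; [split|].
  - exact (IFun_eq_F0 u1).
  - exact (IFun_eq_F0 u2).
  - intros v [v1 v2].
    enough (u = point v) as -> by reflexivity.
    apply hu; split; apply IFun_eq; simpl.
    + exact v1.
    + rw (F_unit p); rewrite v1; reflexivity.
    + exact v2.
    + rw (F_unit q); rewrite v2; reflexivity.
Qed.

(** Converse to [pullback_F0] for discrete opfibrations: functors into them are determined by their
    object part and their composite to the base, so the universal property on objects suffices. *)
Lemma dof_pullback_of_F0 (A H B K : ICat C) (q : IFun A H) (Phi : IFun H K) (p : IFun B K)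
  (pi : IFun A B) :
  is_dofib p -> is_dofib q ->
  @comp (CatC C) _ _ _ p pi = @comp (CatC C) _ _ _ Phi q ->
  is_pullback (F0 p) (F0 Phi) (F0 pi) (F0 q) ->
  @is_pullback (CatC C) _ _ _ _ p Phi pi q.
Proof.
  intros dp dq sq h; split; [exact sq|].
  intros Z a b e.
  destruct (pullback_lift h (IFun_eq_F0 e)) as [u0 [h1 h2]].
  destruct (@dof_functor_lift _ _ q dq Z b u0) as [u [hu0 hu]].
  { exact h2. }
  { intros X z w w1 w2.
    (* Both sides lift the same arrow of [K] from the same point of [B]. *)
    assert (hw : F1 pi ⊚ w = F1 a ⊚ z).
    { apply (dof_ext dp).
      - rw (F_src pi); rewrite w1; rw h1; rw (F_src a); reflexivity.
      - pose proof (IFun_eq_F1 sq) as s; pose proof (IFun_eq_F1 e) as s'.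
        simpl in s, s'; rw s; rewrite w2; rw s'; reflexivity. }
    apply (pullback_ext h).
    - rwl (F_tgt pi); rewrite hw; rw (F_tgt a); rw h1; reflexivity.
    - rwl (F_tgt q); rewrite w2; rw (F_tgt b); rw h2; reflexivity. }
  exists u; split; [split|].
  - apply (dof_functor_ext dp).
    + simpl; rewrite hu0; exact h1.
    + rewrite (@comp_assoc (CatC C)), sq, <- (@comp_assoc (CatC C)), hu.
      symmetry; exact e.
  - exact hu.
  - intros v [v1 v2]; apply (dof_functor_ext dq).
    + rewrite hu0; apply (pullback_ext h); rewrite ?h1, ?h2; symmetry;
        [exact (IFun_eq_F0 v1) | exact (IFun_eq_F0 v2)].
    + rewrite hu, v2; reflexivity.
Qed.

End InternalFunctors.

(** * Discrete opfibrations from actions of an internal category *)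

Section Actions.
Variables (C : Category) (FC : FinComplete C) (K : ICat C).
Variables (B0 : C) (b : Hom B0 (C0 K)).

Let Q := fc_pb FC b (src K).
Let s : Hom (pb_obj Q) B0 := pb_p1 Q.
Let q : Hom (pb_obj Q) (C1 K) := pb_p2 Q.

(** The map [t] transports a point of [B0] along an arrow of [K] out of its image. The laws quantify
    over all elements with the prescribed components, so they can be stated before any unit or
    composition map is constructed. *)
Record is_action (t : Hom (pb_obj Q) B0) : Prop := {
  action_tgt : b ⊚ t = tgt K ⊚ q;
  action_unit : forall (X : C) (z : Hom X (pb_obj Q)),
    q ⊚ z = unit K ⊚ (b ⊚ (s ⊚ z)) -> t ⊚ z = s ⊚ z;
  action_mult : forall (X : C) (z1 z2 z3 : Hom X (pb_obj Q)) (k : Hom X (P K)),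
    p1 K ⊚ k = q ⊚ z1 -> p2 K ⊚ k = q ⊚ z2 -> q ⊚ z3 = mult K ⊚ k ->
    s ⊚ z2 = t ⊚ z1 -> s ⊚ z3 = s ⊚ z1 -> t ⊚ z3 = t ⊚ z2 }.

Variables (t : Hom (pb_obj Q) B0) (ht : is_action t).

Let R := fc_pb FC t s.

Lemma action_composable_eq : tgt K ⊚ (q ⊚ pb_p1 R) = src K ⊚ (q ⊚ pb_p2 R).
Proof.
  rwl (action_tgt ht); rewrite (pb_sq R); unfold s, q; rw (pb_sq Q); reflexivity.
Qed.

(** The universal property of [P K] is a mere proposition, so the map into it is extracted by
    choice. *)
Definition action_composable :
    {k : Hom (pb_obj R) (P K) | p1 K ⊚ k = q ⊚ pb_p1 R /\ p2 K ⊚ k = q ⊚ pb_p2 R} :=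
  constructive_indefinite_description _ (composable_lift action_composable_eq).

Let kR := proj1_sig action_composable.

Lemma action_composable_p1 : p1 K ⊚ kR = q ⊚ pb_p1 R.
Proof. exact (proj1 (proj2_sig action_composable)). Qed.

Lemma action_composable_p2 : p2 K ⊚ kR = q ⊚ pb_p2 R.
Proof. exact (proj2 (proj2_sig action_composable)). Qed.

Lemma action_unit_eq : b ⊚ idm B0 = src K ⊚ (unit K ⊚ b).
Proof. rw (src_unit K); reflexivity. Qed.

Lemma action_mult_eq : b ⊚ (s ⊚ pb_p1 R) = src K ⊚ (mult K ⊚ kR).
Proof.
  rw (src_mult K); rewrite action_composable_p1; unfold s, q; rw (pb_sq Q); reflexivity.
Qed.

Let e : Hom B0 (pb_obj Q) := pb_pair Q action_unit_eq.
Let m : Hom (pb_obj R) (pb_obj Q) := pb_pair Q action_mult_eq.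

Lemma action_ext (X : C) (u v : Hom X (pb_obj Q)) :
  s ⊚ u = s ⊚ v -> q ⊚ u = q ⊚ v -> u = v.
Proof. apply pb_unique. Qed.

Lemma action_s_unit : s ⊚ e = idm B0.
Proof. apply (pb_pair_p1 Q). Qed.
Lemma action_q_unit : q ⊚ e = unit K ⊚ b.
Proof. apply (pb_pair_p2 Q). Qed.
Lemma action_s_mult : s ⊚ m = s ⊚ pb_p1 R.
Proof. apply (pb_pair_p1 Q). Qed.
Lemma action_q_mult : q ⊚ m = mult K ⊚ kR.
Proof. apply (pb_pair_p2 Q). Qed.

(** The category of elements of the action. *)
Definition action_cat : ICat C.
Proof.
  refine {| C0 := B0; C1 := pb_obj Q; src := s; tgt := t; unit := e;
            P := pb_obj R; p1 := pb_p1 R; p2 := pb_p2 R;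
            P_pb := pb_is_pullback R; mult := m |}.
  - exact action_s_unit.
  - rewrite <- action_s_unit; apply (action_unit ht).
    rewrite action_q_unit, action_s_unit; nf; reflexivity.
  - exact action_s_mult.
  - apply (@action_mult _ ht _ (pb_p1 R) (pb_p2 R) m kR).
    + exact action_composable_p1.
    + exact action_composable_p2.
    + exact action_q_mult.
    + symmetry; exact (pb_sq R).
    + exact action_s_mult.
  - intros X f u e1 e2; rewrite <- comp_assoc in e1; apply action_ext.
    + rw action_s_mult; rewrite e1; rw action_s_unit; reflexivity.
    + rw action_q_mult; apply mult_unit_l.
      * rw action_composable_p1; rewrite e1; rw action_q_unit.
        unfold s, q; rw (pb_sq Q); reflexivity.
      * rw action_composable_p2; rewrite e2; reflexivity.
  - intros X f u e1 e2; rewrite <- comp_assoc in e2; apply action_ext.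
    + rw action_s_mult; rewrite e1; reflexivity.
    + rw action_q_mult; apply mult_unit_r.
      * rw action_composable_p1; rewrite e1; reflexivity.
      * rw action_composable_p2; rewrite e2; rw action_q_unit.
        rw (action_tgt ht); reflexivity.
  - intros X u v w z e0 e1 e2 e3 e4; apply action_ext.
    + rw action_s_mult; rewrite e1; rw action_s_mult.
      rw action_s_mult; rewrite e3; reflexivity.
    + rw action_q_mult; rw action_q_mult; apply (@mult_assoc _ _ _ (kR ⊚ u) (kR ⊚ v)).
      * rw action_composable_p2; rw action_composable_p1; rewrite e0; reflexivity.
      * rw action_composable_p1; rewrite e1; rw action_q_mult; reflexivity.
      * rw action_composable_p2; rw action_composable_p2; rewrite e2; reflexivity.
      * rw action_composable_p1; rw action_composable_p1; rewrite e3; reflexivity.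
      * rw action_composable_p2; rewrite e4; rw action_q_mult; reflexivity.
Defined.

Definition action_proj : IFun action_cat K.
Proof.
  refine (@Build_IFun _ action_cat K b q _ _ _ _); simpl.
  - symmetry; exact (pb_sq Q).
  - symmetry; exact (action_tgt ht).
  - exact action_q_unit.
  - intros X u v e1 e2; rw action_q_mult.
    enough (kR ⊚ u = v) as -> by reflexivity.
    apply (pullback_ext (P_pb K)).
    + rw action_composable_p1; rewrite e1; nf; reflexivity.
    + rw action_composable_p2; rewrite e2; nf; reflexivity.
Defined.

Definition action_dof : DOF K :=
  @Build_DOF _ K action_cat action_proj (pb_is_pullback Q).

End Actions.

(** * Existence of pullback functors *)

Section PullbackFunctors.
Variables (C : Category) (FC : FinComplete C).

(** The pullback of [F0 p] along [F0 Phi] carries an action of [H], whose category of elements is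
    the required opfibration. *)
Lemma dof_pullback_exists (H K : ICat C) (Phi : IFun H K) (p : DOF K) :
  exists (q : DOF H) (pi : IFun (dof_dom q) (dof_dom p)),
    @is_pullback (CatC C) _ _ _ _ (dof_proj p) Phi pi (dof_proj q).
Proof.
  destruct p as [B p dp]; simpl.
  pose (A := fc_pb FC (F0 p) (F0 Phi)).
  pose (Q := fc_pb FC (pb_p2 A) (src H)).
  (* [l] lifts to [B] the image in [K] of an arrow of [H]; the action [t] moves the first component
     along [l] and the second along the arrow of [H] itself. *)
  destruct (@dof_lift _ _ _ p dp _ (pb_p1 A ⊚ pb_p1 Q) (F1 Phi ⊚ pb_p2 Q)) as [l [l1 l2]].
  { rw (pb_sq A); rw (F_src Phi); rewrite (pb_sq Q); reflexivity. }
  assert (et : F0 p ⊚ (tgt B ⊚ l) = F0 Phi ⊚ (tgt H ⊚ pb_p2 Q)).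
  { rwl (F_tgt p); rewrite l2; rw (F_tgt Phi); reflexivity. }
  pose (t := pb_pair A et).
  assert (t1 : pb_p1 A ⊚ t = tgt B ⊚ l) by apply pb_pair_p1.
  assert (t2 : pb_p2 A ⊚ t = tgt H ⊚ pb_p2 Q) by apply pb_pair_p2.
  assert (ht : is_action t).
  { constructor.
    - exact t2.
    - fold Q; intros X z e; apply (pb_unique (p := A)).
      + rw t1.
        rewrite (@dof_over_unit _ _ _ p dp _ _ (F0 Phi ⊚ (pb_p2 A ⊚ (pb_p1 Q ⊚ z)))).
        * rw l1; reflexivity.
        * rw l2; rewrite e; rw (F_unit Phi); reflexivity.
      + rw t2; rewrite e; rw (tgt_unit H); reflexivity.
    - fold Q; intros X z1 z2 z3 k k1 k2 e3 e2 e1; apply (pb_unique (p := A)).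
      + rw t1; rw t1.
        destruct (@composable_lift _ B _ (l ⊚ z1) (l ⊚ z2)) as [w [w1 w2]].
        { rw l1; rewrite e2; rw t1; reflexivity. }
        (* A composite of lifts is the lift of the composite. *)
        assert (l ⊚ z3 = mult B ⊚ w) as ->.
        { apply (dof_ext dp).
          - rw l1; rewrite e1; rw (src_mult B); rewrite w1; rw l1; reflexivity.
          - destruct (functor_composable Phi k) as [k' [k'1 k'2]].
            rw l2; rewrite e3, (functor_mult k'1 k'2); symmetry.
            apply functor_mult; rewrite ?k'1, ?k'2, ?w1, ?w2, ?k1, ?k2; rw l2; reflexivity. }
        rw (tgt_mult B); rewrite w2; reflexivity.
      + rw t2; rw t2; rewrite e3; rw (tgt_mult H); rewrite k2; reflexivity. }
  pose (q := action_dof ht).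
  destruct (@dof_functor_lift _ _ _ p dp (dof_dom q)
    (@comp (CatC C) _ _ _ Phi (dof_proj q)) (pb_p1 A)) as [pi [pi0 hpi]].
  - exact (pb_sq A).
  - simpl; fold Q; intros X z w w1 w2.
    rw t1.
    assert (w = l ⊚ z) as -> by
      (apply (dof_ext dp); [rewrite w1; rw l1 | rewrite w2; rw l2]; reflexivity).
    reflexivity.
  - exists q, pi; apply dof_pullback_of_F0.
    + exact dp.
    + exact (dof_is q).
    + exact hpi.
    + rewrite pi0; exact (pb_is_pullback A).
Qed.

(** Pullbacks are chosen object by object; their universal property supplies the morphisms, and its
    uniqueness clause gives functoriality. *)
Lemma pullback_functor_exists (H K : ICat C) (Phi : IFun H K) :
  exists G pi, @is_pullback_functor C H K Phi G pi.
Proof.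
  pose (ob := fun p => constructive_indefinite_description _ (dof_pullback_exists Phi p)).
  pose (pi := fun p => proj1_sig (constructive_indefinite_description _ (proj2_sig (ob p)))).
  assert (hpi : forall p, @is_pullback (CatC C) _ _ _ _ (dof_proj p) Phi (pi p)
                            (dof_proj (proj1_sig (ob p)))).
  { intro p; exact (proj2_sig (constructive_indefinite_description _ (proj2_sig (ob p)))). }
  assert (ex : forall p p' (f : DOF_hom p p'),
    exists g : DOF_hom (proj1_sig (ob p)) (proj1_sig (ob p')),
      @comp (CatC C) _ _ _ (pi p') (proj1_sig g) = @comp (CatC C) _ _ _ (proj1_sig f) (pi p)).
  { intros p p' [f hf].
    destruct (@pullback_lift (CatC C) _ _ _ _ _ _ _ _ (hpi p') _
      (@comp (CatC C) _ _ _ f (pi p)) (dof_proj (proj1_sig (ob p)))) as [g [g1 g2]].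
    - rewrite comp_assoc, hf; exact (proj1 (hpi p)).
    - exists (exist _ g g2); exact g1. }
  pose (mor := fun p p' f => constructive_indefinite_description _ (ex p p' f)).
  assert (hmor : forall p p' f,
    @comp (CatC C) _ _ _ (pi p') (proj1_sig (proj1_sig (mor p p' f)))
      = @comp (CatC C) _ _ _ (proj1_sig f) (pi p)).
  { intros p p' f; exact (proj2_sig (mor p p' f)). }
  assert (uniq : forall p p' (f g : DOF_hom (proj1_sig (ob p)) (proj1_sig (ob p'))),
    @comp (CatC C) _ _ _ (pi p') (proj1_sig f) = @comp (CatC C) _ _ _ (pi p') (proj1_sig g) ->
    f = g).
  { intros p p' f g e; apply DOF_hom_eq.
    apply (@pullback_ext (CatC C) _ _ _ _ _ _ _ _ (hpi p')); [exact e|].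
    rewrite (proj2_sig f); symmetry; exact (proj2_sig g). }
  unshelve refine (let G : Functor (doFib K) (doFib H) :=
    {| fobj := fun p : doFib K => proj1_sig (ob p) : doFib H;
       fmap := fun p p' f => proj1_sig (mor p p' f) |} in _).
  { intro p; apply uniq; rewrite hmor; transitivity (pi p).
    - exact (@comp_id_l (CatC C) _ _ (pi p)).
    - symmetry; exact (@comp_id_r (CatC C) _ _ (pi p)). }
  { intros p p' p'' g f; apply uniq; rewrite hmor.
    change (@comp (CatC C) _ _ _ (@comp (CatC C) _ _ _ (proj1_sig g) (proj1_sig f)) (pi p)
      = @comp (CatC C) _ _ _ (pi p'') (@comp (CatC C) _ _ _ (proj1_sig (proj1_sig (mor _ _ g)))
          (proj1_sig (proj1_sig (mor _ _ f))))).
    symmetry; rewrite (@comp_assoc (CatC C)), (hmor _ _ g), <- (@comp_assoc (CatC C)), (hmor _ _ f).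
    apply (@comp_assoc (CatC C)). }
  exists G, pi; split; [exact hpi | exact hmor].
Qed.

End PullbackFunctors.

(** * Morphisms of discrete opfibrations in terms of objects *)

Section Morphisms.
Variables (C : Category) (K : ICat C).

Lemma DOF_hom_ext (p p' : DOF K) (F G : DOF_hom p p') :
  F0 (proj1_sig F) = F0 (proj1_sig G) -> F = G.
Proof.
  intro e; apply DOF_hom_eq, (dof_functor_ext (dof_is p')); [exact e|].
  rewrite (proj2_sig F); symmetry; exact (proj2_sig G).
Qed.

Lemma DOF_hom_F0 (p p' : DOF K) (F : DOF_hom p p') :
  F0 (dof_proj p') ⊚ F0 (proj1_sig F) = F0 (dof_proj p).
Proof. exact (IFun_eq_F0 (proj2_sig F)). Qed.

Lemma DOF_hom_F1 (p p' : DOF K) (F : DOF_hom p p') :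
  F1 (dof_proj p') ⊚ F1 (proj1_sig F) = F1 (dof_proj p).
Proof. exact (IFun_eq_F1 (proj2_sig F)). Qed.

Lemma DOF_hom_exists (p p' : DOF K) (h : Hom (C0 (dof_dom p)) (C0 (dof_dom p'))) :
  F0 (dof_proj p') ⊚ h = F0 (dof_proj p) ->
  (forall (X : C) (z : Hom X (C1 (dof_dom p))) (w : Hom X (C1 (dof_dom p'))),
     src _ ⊚ w = h ⊚ (src _ ⊚ z) -> F1 (dof_proj p') ⊚ w = F1 (dof_proj p) ⊚ z ->
     tgt _ ⊚ w = h ⊚ (tgt _ ⊚ z)) ->
  exists F : DOF_hom p p', F0 (proj1_sig F) = h.
Proof.
  intros e ht; destruct (dof_functor_lift (dof_is p') e ht) as [F [F0h hF]].
  exists (exist _ F hF); exact F0h.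
Qed.

End Morphisms.

(** * Consequences of effective descent in the base category *)

Section Descent.
Variables (C : Category) (FC : FinComplete C).

Lemma disc_dof_tgt (Y : C) (p : DOF (disc Y)) (T : C) (z : Hom T (C1 (dof_dom p))) :
  tgt _ ⊚ z = src _ ⊚ z.
Proof.
  apply (@dof_over_unit _ _ _ _ (dof_is p) _ _ (F1 (dof_proj p) ⊚ z)).
  simpl; nf; reflexivity.
Qed.

Lemma disc_dof_hom_exists (Y : C) (p p' : DOF (disc Y))
  (h : Hom (C0 (dof_dom p)) (C0 (dof_dom p'))) :
  F0 (dof_proj p') ⊚ h = F0 (dof_proj p) ->
  exists F : DOF_hom p p', F0 (proj1_sig F) = h.
Proof.
  intro e; apply DOF_hom_exists; [exact e|].
  intros X z w w1 _; rewrite !disc_dof_tgt; exact w1.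
Qed.

(** Objects over [Y], seen as discrete opfibrations over [disc Y]. *)
Definition slice_dof (Y Z : C) (g : Hom Z Y) : DOF (disc Y).
Proof.
  refine (@Build_DOF _ (disc Y) (disc Z) (@point C Z (disc Y) g) _).
  split; simpl; [nf; reflexivity|].
  intros X a b; nf; intros <-; exists a.
  split; [split; nf; reflexivity|].
  intros u [e _]; revert e; nf; auto.
Defined.

Variables (X Y : C) (f : Hom X Y).
Hypothesis ed : effective_descent FC f.

(* Morphisms [Z -> W] are morphisms over [Y] into [W * Y], whose descent datum is
   trivial, so full faithfulness of pullback along [f] says that pullbacks of [f]
   are coequalizers of their kernel pairs. *)
Lemma effective_descent_cover (Z Q : C) (g : Hom Z Y) (e : Hom Q Z) (x : Hom Q X) :
  is_pullback g f e x -> cover e.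
Proof.
  intro hQ; destruct ed as [[G [pi hG]] eqv].
  pose proof (equivalence_fully_faithful (eqv G pi hG)) as ff.
  pose (E := slice_dof g).
  pose proof (pullback_F0 (proj1 hG E)) as hE; simpl in hE.
  (* Covers are stable under isomorphism, so it suffices to treat the pullback provided by [G]. *)
  destruct (pullbacks_iso hE hQ) as [i [j [ij [ji [<- _]]]]].
  apply (cover_iso ij ji); clear Q x hQ i j ij ji.
  intros W h hh.
  pose (WY := fc_prod FC W Y).
  pose (E' := slice_dof (pr2 WY)).
  pose proof (pullback_F0 (proj1 hG E')) as hE'; simpl in hE'.
  destruct (@pullback_lift _ _ _ _ _ _ _ _ _ hE' _
    (pairing WY h (g ⊚ F0 (pi E))) (F0 (dof_proj (G E)))) as [m [m1 m2]].
  { rewrite pairing_pr2; exact (proj1 hE). }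
  (* Arrows over [disc Y] have equal source and target, so source and target upstairs agree in the
     kernel pair of [F0 (pi F)]. This is where the hypothesis on [h] applies. *)
  assert (htgt : forall (T : C) (F : DOF (disc Y)) (z : Hom T (C1 (dof_dom (G F)))),
    F0 (pi F) ⊚ (tgt _ ⊚ z) = F0 (pi F) ⊚ (src _ ⊚ z)).
  { intros T F z; rwl (F_tgt (pi F)); rewrite disc_dof_tgt; rw (F_src (pi F)); reflexivity. }
  destruct (@DOF_hom_exists _ _ (G E) (G E') m m2) as [M hM].
  { intros T z w w1 w2; apply (pullback_ext hE').
    - rewrite htgt, w1, !(comp_post m1).
      apply pairing_unique.
      + rw (pairing_pr1 WY h (g ⊚ F0 (pi E))).
        rw (pairing_pr1 WY h (g ⊚ F0 (pi E))); apply hh; symmetry; exact (htgt _ E z).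
      + rw (pairing_pr2 WY h (g ⊚ F0 (pi E))).
        rw (pairing_pr2 WY h (g ⊚ F0 (pi E))).
        apply f_equal; symmetry; exact (htgt _ E z).
    - rw m2; rwl (F_tgt (dof_proj (G E'))); rewrite w2.
      rw (F_tgt (dof_proj (G E))); reflexivity. }
  destruct (ff E E' M) as [F [hF _]].
  assert (key : forall F' : DOF_hom E E', F0 (proj1_sig F') ⊚ F0 (pi E) =
    F0 (pi E') ⊚ F0 (proj1_sig (fmap G F'))).
  { intro F'; symmetry; exact (IFun_eq_F0 (proj2 hG E E' F')). }
  exists (pr1 WY ⊚ F0 (proj1_sig F)); split.
  - nf; rewrite key, hF, hM; transitivity (pr1 WY ⊚ pairing WY h (g ⊚ F0 (pi E))).
    + exact (f_equal (fun v => pr1 WY ⊚ v) m1).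
    + apply pairing_pr1.
  - intros h' eh'.
    (* A competing factorization yields a morphism [F'] with the same pullback [M], and faithfulness
       identifies it with [F]. *)
    destruct (@disc_dof_hom_exists _ E E' (pairing WY h' g)) as [F' hF'].
    { apply pairing_pr2. }
    enough (F = F') as -> by (rewrite hF'; apply pairing_pr1).
    destruct (ff E E' M) as [F'' [_ hu]].
    rewrite <- (hu F hF); apply hu, DOF_hom_ext, (pullback_ext hE').
    + rewrite hM; refine (eq_trans (eq_sym (key F')) (eq_trans _ (eq_sym m1))).
      rewrite hF'; apply pairing_unique.
      * rw (pairing_pr1 WY h' g); rewrite pairing_pr1; exact eh'.
      * rw (pairing_pr2 WY h' g); rewrite pairing_pr2; reflexivity.
    + rewrite hM, m2; apply DOF_hom_F0.
Qed.

(** Essential surjectivity gives an object over [Y] whose pullback is isomorphic to [A]. The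
    projection collapses arrows of [A], because over [disc Y] source and target coincide. *)
Lemma effective_descent_object (A : DOF (kp_cat FC f)) :
  exists (B0 : C) (b : Hom B0 Y) (pi : Hom (C0 (dof_dom A)) B0),
    is_pullback b f pi (F0 (dof_proj A)) /\
    forall (T : C) (z : Hom T (C1 (dof_dom A))), pi ⊚ (tgt _ ⊚ z) = pi ⊚ (src _ ⊚ z).
Proof.
  destruct ed as [[G [pi hG]] eqv].
  destruct (equivalence_essentially_surjective (eqv G pi hG) A) as [E [i [j [ji ij]]]].
  pose proof (pullback_F0 (proj1 hG E)) as hE; simpl in hE.
  pose proof (IFun_eq_F0 (f_equal (@proj1_sig _ _) ij)) as ij0.
  pose proof (IFun_eq_F0 (f_equal (@proj1_sig _ _) ji)) as ji0; simpl in ij0, ji0.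
  exists (C0 (dof_dom E)), (F0 (dof_proj E)), (F0 (pi E) ⊚ F0 (proj1_sig j)); split.
  - apply (pullback_of_iso hE (i := F0 (proj1_sig j)) (j := F0 (proj1_sig i))).
    + reflexivity.
    + apply (DOF_hom_F0 j).
    + exact ji0.
    + exact ij0.
  - intros T z.
    rwl (F_tgt (proj1_sig j)); rwl (F_tgt (pi E)); rewrite disc_dof_tgt.
    rw (F_src (pi E)); rw (F_src (proj1_sig j)); reflexivity.
Qed.

End Descent.

(** * Vertical arrows and the kernel pair groupoid *)

Section FullyFaithful.
Variables (C : Category) (FC : FinComplete C) (H K : ICat C) (Phi : IFun H K).
Hypothesis ff : fully_faithful FC Phi.

Lemma full_lift (T : C) (x y : Hom T (C0 H)) (k : Hom T (C1 K)) :
  src K ⊚ k = F0 Phi ⊚ x -> tgt K ⊚ k = F0 Phi ⊚ y ->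
  exists h : Hom T (C1 H), src H ⊚ h = x /\ tgt H ⊚ h = y /\ F1 Phi ⊚ h = k.
Proof.
  intros ex ey.
  destruct (@pullback_lift _ _ _ _ _ _ _ _ _ ff T k
    (pairing (fc_prod FC (C0 H) (C0 H)) x y)) as [h [h1 h2]].
  - apply pairing_unique.
    + rewrite !comp_assoc, !pairing_pr1; rw (pairing_pr1 (fc_prod FC (C0 H) (C0 H)) x y).
      exact ex.
    + rewrite !comp_assoc, !pairing_pr2; rw (pairing_pr2 (fc_prod FC (C0 H) (C0 H)) x y).
      exact ey.
  - exists h; split; [|split; [|exact h1]].
    + rewrite <- (pairing_pr1 (fc_prod FC (C0 H) (C0 H)) x y), <- h2.
      rewrite comp_assoc, pairing_pr1; reflexivity.
    + rewrite <- (pairing_pr2 (fc_prod FC (C0 H) (C0 H)) x y), <- h2.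
      rewrite comp_assoc, pairing_pr2; reflexivity.
Qed.

Lemma faithful_ext (T : C) (h h' : Hom T (C1 H)) :
  src H ⊚ h = src H ⊚ h' -> tgt H ⊚ h = tgt H ⊚ h' -> F1 Phi ⊚ h = F1 Phi ⊚ h' -> h = h'.
Proof.
  intros es et ek; apply (pullback_ext ff); [exact ek|].
  apply pairing_unique; rewrite !comp_assoc, ?pairing_pr1, ?pairing_pr2; assumption.
Qed.

Lemma vertical_arrow (T : C) (x y : Hom T (C0 H)) :
  F0 Phi ⊚ x = F0 Phi ⊚ y ->
  exists h : Hom T (C1 H),
    src H ⊚ h = x /\ tgt H ⊚ h = y /\ F1 Phi ⊚ h = unit K ⊚ (F0 Phi ⊚ x).
Proof.
  intro e; apply full_lift; [rw (src_unit K) | rw (tgt_unit K)]; auto.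
Qed.

(** A pair of points with the same image is sent to the vertical arrow joining them. The functor
    laws hold by faithfulness, since in [K] only identities are composed. *)
Lemma kernel_pair_functor :
  exists J : IFun (kp_cat FC (F0 Phi)) H, F0 J = idm (C0 H) /\
    F1 Phi ⊚ F1 J = unit K ⊚ (F0 Phi ⊚ src (kp_cat FC (F0 Phi))).
Proof.
  set (N := kp_cat FC (F0 Phi)).
  assert (sq : F0 Phi ⊚ src N = F0 Phi ⊚ tgt N) by apply pb_sq.
  destruct (vertical_arrow sq) as [j [j1 [j2 j3]]].
  unshelve refine (ex_intro _ (@Build_IFun _ N H (idm _) j _ _ _ _) _).
  - nf; exact j1.
  - nf; exact j2.
  - apply faithful_ext.
    + rw j1; exact (eq_trans (src_unit N) (eq_sym (src_unit H))).
    + rw j2; exact (eq_trans (tgt_unit N) (eq_sym (tgt_unit H))).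
    + rw j3; refine (eq_trans _ (eq_sym (F_unit Phi))).
      transitivity (unit K ⊚ (F0 Phi ⊚ idm (C0 H))); [|nf; reflexivity].
      exact (f_equal (fun v => unit K ⊚ (F0 Phi ⊚ v)) (src_unit N)).
  - intros T u v e1 e2; revert e1 e2; nf; intros e1 e2; apply faithful_ext.
    + rw j1; rw (src_mult N); rw (src_mult H); rewrite e1; rw j1; reflexivity.
    + rw j2; rw (tgt_mult N); rw (tgt_mult H); rewrite e2; rw j2; reflexivity.
    + rw j3; rw (src_mult N).
      destruct (functor_composable Phi v) as [w [w1 w2]].
      rewrite (functor_mult w1 w2); symmetry.
      (* The two arrows of a composable pair lie over the same point of [C0 K]. *)
      assert (es : F0 Phi ⊚ (src N ⊚ (p2 N ⊚ u)) = F0 Phi ⊚ (src N ⊚ (p1 N ⊚ u))).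
      { rwl (proj1 (P_pb N)); rwl sq; reflexivity. }
      apply mult_unit_l; rewrite ?w1, ?w2, ?e1, ?e2; rw j3.
      * rw (src_unit K); reflexivity.
      * exact (f_equal (fun v => unit K ⊚ v) es).
  - split; [reflexivity | exact j3].
Qed.

(** Restricting [A] along the kernel pair functor gives a descent datum [R] with the same objects up
    to isomorphism. Every vertical arrow of [A] comes from [R], so the projection collapses it. *)
Lemma descent_object (A : DOF H) :
  effective_descent FC (F0 Phi) ->
  exists (B0 : C) (b : Hom B0 (C0 K)) (pi : Hom (C0 (dof_dom A)) B0),
    is_pullback b (F0 Phi) pi (F0 (dof_proj A)) /\
    forall (T : C) (z : Hom T (C1 (dof_dom A))),
      F1 Phi ⊚ (F1 (dof_proj A) ⊚ z) = unit K ⊚ (F0 Phi ⊚ (F0 (dof_proj A) ⊚ (src _ ⊚ z))) ->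
      pi ⊚ (tgt _ ⊚ z) = pi ⊚ (src _ ⊚ z).
Proof.
  intro ed; destruct kernel_pair_functor as [J [J0 J1]].
  destruct (dof_pullback_exists FC J A) as [R [r hr]].
  pose proof (pullback_F0 hr) as hr0.
  pose proof (IFun_eq_F0 (proj1 hr)) as sq0; pose proof (IFun_eq_F1 (proj1 hr)) as sq1.
  simpl in sq0, sq1.
  (* Since [F0 J] is an identity, [F0 r] is invertible; [i] is its inverse. *)
  destruct (@pullback_lift _ _ _ _ _ _ _ _ _ hr0 _ (idm _) (F0 (dof_proj A))) as [i [i1 i2]].
  { rewrite J0; nf; reflexivity. }
  assert (ir : i ⊚ F0 r = idm _).
  { apply (pullback_ext hr0).
    - rw i1; reflexivity.
    - rw i2; refine (eq_trans sq0 _); rewrite J0; apply comp_id_l. }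
  destruct (effective_descent_object ed R) as [B0 [b [pi [hpi hz]]]].
  exists B0, b, (pi ⊚ i); split.
  - exact (pullback_of_iso hpi eq_refl i2 ir i1).
  - intros T z ez.
    set (q := dof_proj A) in *.
    pose (x := src H ⊚ (F1 q ⊚ z)); pose (y := tgt H ⊚ (F1 q ⊚ z)).
    assert (ex : F0 Phi ⊚ x = F0 Phi ⊚ (F0 q ⊚ (src _ ⊚ z))).
    { unfold x; rw (F_src q); reflexivity. }
    assert (ey : F0 Phi ⊚ x = F0 Phi ⊚ y).
    { rewrite ex; unfold y; rwl (F_tgt Phi); rewrite ez; rw (tgt_unit K); reflexivity. }
    (* [n] is the pair of endpoints in [C0 H] of the image of [z]. By faithfulness [J] sends it to
       that image, and its lift [w] in [R] is then mapped to [z] by [r]. *)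
    pose (n := pb_pair (fc_pb FC (F0 Phi) (F0 Phi)) ey).
    assert (n1 : src (kp_cat FC (F0 Phi)) ⊚ n = x) by apply (pb_pair_p1 (fc_pb FC _ _)).
    assert (n2 : tgt (kp_cat FC (F0 Phi)) ⊚ n = y) by apply (pb_pair_p2 (fc_pb FC _ _)).
    assert (Jn : F1 J ⊚ n = F1 q ⊚ z).
    { apply faithful_ext.
      - rw (F_src J); rewrite J0; nf; exact n1.
      - rw (F_tgt J); rewrite J0; nf; exact n2.
      - rw J1; refine (eq_trans (f_equal (fun v => unit K ⊚ (F0 Phi ⊚ v)) n1) _).
        rewrite ez, ex; reflexivity. }
    destruct (@dof_lift _ _ _ _ (dof_is R) _ (i ⊚ (src _ ⊚ z)) n) as [w [w1 w2]].
    { rw i2; rewrite n1; unfold x; rw (F_src q); reflexivity. }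
    assert (rw_z : F1 r ⊚ w = z).
    { apply (dof_ext (dof_is A)).
      - rw (F_src r); rewrite w1; rw i1; reflexivity.
      - rw sq1; exact (eq_trans (f_equal (fun v => F1 J ⊚ v) w2) Jn). }
    nf; rewrite <- rw_z; rw (F_tgt r); rw (F_src r).
    rewrite !(comp_post ir); nf; apply hz.
Qed.

End FullyFaithful.

(** * Local lifting and descent of the action *)

Section DescentAlongFunctor.
Variables (C : Category) (FC : FinComplete C) (H K : ICat C) (Phi : IFun H K).
Hypothesis ff : fully_faithful FC Phi.
Hypothesis ed : effective_descent FC (F0 Phi).

(** The map [c] is the base change of [F0 Phi] along [b ⊚ x], hence a cover. Local arguments below
    always mean after such an epimorphism. *)
Lemma local_point (A0 B0 T : C) (b : Hom B0 (C0 K)) (pi : Hom A0 B0) (q : Hom A0 (C0 H))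
  (x : Hom T B0) :
  is_pullback b (F0 Phi) pi q ->
  exists (T' : C) (c : Hom T' T) (a : Hom T' A0), epi c /\ pi ⊚ a = x ⊚ c.
Proof.
  intro h; pose (Q := fc_pb FC (b ⊚ x) (F0 Phi)).
  destruct (@pullback_lift _ _ _ _ _ _ _ _ _ h _ (x ⊚ pb_p1 Q) (pb_p2 Q)) as [a [a1 _]].
  { rewrite comp_assoc; exact (pb_sq Q). }
  exists (pb_obj Q), (pb_p1 Q), a; split; [|exact a1].
  exact (cover_epi (effective_descent_cover ed (pb_is_pullback Q))).
Qed.

Section Local.
Variable A : DOF H.
Let q := dof_proj A.

(** Base change makes the target of [k] come from [C0 H]; fullness then lifts [k] to [H], and the
    opfibration lifts it to [A] from [a]. *)
Lemma local_arrow (T : C) (a : Hom T (C0 (dof_dom A))) (k : Hom T (C1 K)) :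
  src K ⊚ k = F0 Phi ⊚ (F0 q ⊚ a) ->
  exists (T' : C) (c : Hom T' T) (z : Hom T' (C1 (dof_dom A))),
    epi c /\ src _ ⊚ z = a ⊚ c /\ F1 Phi ⊚ (F1 q ⊚ z) = k ⊚ c.
Proof.
  intro e; pose (Q := fc_pb FC (tgt K ⊚ k) (F0 Phi)).
  destruct (@full_lift _ _ _ _ _ ff _ (F0 q ⊚ (a ⊚ pb_p1 Q)) (pb_p2 Q) (k ⊚ pb_p1 Q))
    as [h [h1 [_ h3]]].
  { rw e; reflexivity. }
  { rewrite comp_assoc; exact (pb_sq Q). }
  destruct (@dof_lift _ _ _ q (dof_is A) _ (a ⊚ pb_p1 Q) h) as [z [z1 z2]].
  { symmetry; exact h1. }
  exists (pb_obj Q), (pb_p1 Q), z; split; [|split; [exact z1|]].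
  - exact (cover_epi (effective_descent_cover ed (pb_is_pullback Q))).
  - rewrite z2; exact h3.
Qed.

Variables (B0 : C) (b : Hom B0 (C0 K)) (pi : Hom (C0 (dof_dom A)) B0).
Hypothesis hpi : is_pullback b (F0 Phi) pi (F0 q).

Definition collapses_vertical (W : C) (g : Hom (C0 (dof_dom A)) W) : Prop :=
  forall (T : C) (z : Hom T (C1 (dof_dom A))),
    F1 Phi ⊚ (F1 q ⊚ z) = unit K ⊚ (F0 Phi ⊚ (F0 q ⊚ (src _ ⊚ z))) ->
    g ⊚ (tgt _ ⊚ z) = g ⊚ (src _ ⊚ z).

Hypothesis hvert : collapses_vertical pi.

Lemma local_lift (T : C) (x : Hom T B0) (k : Hom T (C1 K)) :
  src K ⊚ k = b ⊚ x ->
  exists (T' : C) (c : Hom T' T) (z : Hom T' (C1 (dof_dom A))),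
    epi c /\ pi ⊚ (src _ ⊚ z) = x ⊚ c /\ F1 Phi ⊚ (F1 q ⊚ z) = k ⊚ c.
Proof.
  intro e; destruct (local_point x hpi) as [T1 [c1 [a [ep1 ha]]]].
  destruct (@local_arrow T1 a (k ⊚ c1)) as [T2 [c2 [z [ep2 [z1 z2]]]]].
  { rw e; rewrite <- ha; rw (proj1 hpi); reflexivity. }
  exists T2, (c1 ⊚ c2), z; split; [|split].
  - exact (epi_comp ep2 ep1).
  - rewrite z1; rw ha; reflexivity.
  - rewrite z2; nf; reflexivity.
Qed.

(** The vertical arrow between the images in [H] is lifted from [a]. Its target is [a']: the two
    agree in [C0 H] by construction, and in [B0] because [pi] collapses the lift. *)
Lemma vertical_lift (T : C) (a a' : Hom T (C0 (dof_dom A))) :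
  pi ⊚ a = pi ⊚ a' ->
  exists z : Hom T (C1 (dof_dom A)),
    src _ ⊚ z = a /\ tgt _ ⊚ z = a' /\
    F1 Phi ⊚ (F1 q ⊚ z) = unit K ⊚ (F0 Phi ⊚ (F0 q ⊚ (src _ ⊚ z))).
Proof.
  intro e.
  destruct (@vertical_arrow _ _ _ _ _ ff _ (F0 q ⊚ a) (F0 q ⊚ a')) as [h [h1 [h2 h3]]].
  { rwl (proj1 hpi); rewrite e; rw (proj1 hpi); reflexivity. }
  destruct (@dof_lift _ _ _ q (dof_is A) _ a h) as [z [z1 z2]]; [symmetry; exact h1|].
  assert (hz : F1 Phi ⊚ (F1 q ⊚ z) = unit K ⊚ (F0 Phi ⊚ (F0 q ⊚ (src _ ⊚ z)))).
  { rewrite z2, z1; exact h3. }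
  exists z; split; [exact z1 | split; [|exact hz]].
  apply (pullback_ext hpi).
  - rewrite (hvert hz), z1; exact e.
  - rwl (F_tgt q); rewrite z2; exact h2.
Qed.

(* Two lifts of the same arrow of [K] differ by vertical arrows at both ends. *)
Lemma target_unique (T : C) (z z' : Hom T (C1 (dof_dom A))) :
  pi ⊚ (src _ ⊚ z) = pi ⊚ (src _ ⊚ z') ->
  F1 Phi ⊚ (F1 q ⊚ z) = F1 Phi ⊚ (F1 q ⊚ z') ->
  pi ⊚ (tgt _ ⊚ z) = pi ⊚ (tgt _ ⊚ z').
Proof.
  intros es ek.
  destruct (vertical_lift es) as [v [v1 [v2 v3]]].
  destruct (@vertical_arrow _ _ _ _ _ ff _ (F0 q ⊚ (tgt _ ⊚ z)) (F0 q ⊚ (tgt _ ⊚ z')))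
    as [h [h1 [h2 h3]]].
  { rwl (F_tgt q); rwl (F_tgt Phi); rewrite ek; rw (F_tgt Phi); rw (F_tgt q); reflexivity. }
  destruct (@dof_lift _ _ _ q (dof_is A) _ (tgt _ ⊚ z) h) as [w [w1 w2]].
  { symmetry; exact h1. }
  assert (w3 : F1 Phi ⊚ (F1 q ⊚ w) = unit K ⊚ (F0 Phi ⊚ (F0 q ⊚ (src _ ⊚ w)))).
  { rewrite w1, w2; exact h3. }
  rewrite <- w1, <- (hvert w3).
  destruct (@composable_lift _ (dof_dom A) _ z w) as [l [l1 l2]]; [symmetry; exact w1|].
  destruct (@composable_lift _ (dof_dom A) _ v z') as [r [r1 r2]]; [exact v2|].
  (* The square formed by [z], [w], [v] and [z'] commutes, so [w] and [z'] have the same target. *)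
  enough (e : mult (dof_dom A) ⊚ l = mult (dof_dom A) ⊚ r).
  { rewrite <- l2, <- r2; rwl (tgt_mult (dof_dom A)); rewrite e.
    rw (tgt_mult (dof_dom A)); reflexivity. }
  destruct (functor_composable q l) as [l' [l1' l2']].
  destruct (functor_composable q r) as [r' [r1' r2']].
  destruct (functor_composable Phi l') as [l'' [l1'' l2'']].
  destruct (functor_composable Phi r') as [r'' [r1'' r2'']].
  rewrite l1 in l1'; rewrite l2 in l2'; rewrite r1 in r1'; rewrite r2 in r2'.
  rewrite l1' in l1''; rewrite l2' in l2''; rewrite r1' in r1''; rewrite r2' in r2''.
  apply (dof_ext (dof_is A)).
  - rw (src_mult (dof_dom A)); rw (src_mult (dof_dom A)); rewrite l1, r1, v1; reflexivity.
  - fold q; rewrite (@functor_mult _ _ _ q _ l l'), (@functor_mult _ _ _ q _ r r');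
      try (rewrite ?l1, ?l2, ?r1, ?r2; assumption).
    apply (faithful_ext ff).
    + rw (src_mult H); rw (src_mult H); rewrite l1', r1'.
      rw (F_src q); rw (F_src q); rewrite v1; reflexivity.
    + rw (tgt_mult H); rw (tgt_mult H); rewrite l2', r2'.
      rewrite w2, h2; rw (F_tgt q); reflexivity.
    + rewrite (@functor_mult _ _ _ Phi _ l' l''), (@functor_mult _ _ _ Phi _ r' r'');
        try (rewrite ?l1', ?l2', ?r1', ?r2'; assumption).
      (* In [K] the vertical factors become identities, leaving the common image of [z] and [z']. *)
      transitivity (F1 Phi ⊚ (F1 q ⊚ z)).
      * apply mult_unit_r; [exact l1''|].
        rewrite l2'', w3, w1; rw (F_tgt Phi); rw (F_tgt q); reflexivity.
      * rewrite ek; symmetry; apply mult_unit_l; [|exact r2''].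
        rewrite r1'', v3.
        rw (F_src Phi); rw (F_src q); rewrite <- v2.
        rwl (F_tgt q); rwl (F_tgt Phi); rewrite v3; rw (tgt_unit K); reflexivity.
Qed.

Let Q := fc_pb FC b (src K).

(** Asking this of every lift [z] allows the action laws to be verified on whichever lift is
    convenient. *)
Definition descends (t : Hom (pb_obj Q) B0) : Prop :=
  forall (T : C) (y : Hom T (pb_obj Q)) (z : Hom T (C1 (dof_dom A))),
    pi ⊚ (src _ ⊚ z) = pb_p1 Q ⊚ y -> F1 Phi ⊚ (F1 q ⊚ z) = pb_p2 Q ⊚ y ->
    t ⊚ y = pi ⊚ (tgt _ ⊚ z).

(* The target map of [A] descends along the two covers [E' -> E -> pb_obj Q], which
   choose a lift to [C0 H] of the source and then of the target of an arrow of [K]. *)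
Lemma descended_target_exists : exists t, descends t.
Proof.
  pose (E := fc_pb FC (src K ⊚ pb_p2 Q) (F0 Phi)).
  pose (E' := fc_pb FC (tgt K ⊚ (pb_p2 Q ⊚ pb_p1 E)) (F0 Phi)).
  destruct (@pullback_lift _ _ _ _ _ _ _ _ _ hpi _ (pb_p1 Q ⊚ pb_p1 E) (pb_p2 E))
    as [a [a1 a2]].
  { rw (pb_sq Q); rewrite comp_assoc; exact (pb_sq E). }
  destruct (@full_lift _ _ _ _ _ ff _ (F0 q ⊚ (a ⊚ pb_p1 E')) (pb_p2 E')
    (pb_p2 Q ⊚ (pb_p1 E ⊚ pb_p1 E'))) as [h [h1 [h2 h3]]].
  { rw a2; rewrite (comp_assoc (F0 Phi)), <- (pb_sq E); nf; reflexivity. }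
  { rewrite <- (pb_sq E'); nf; reflexivity. }
  destruct (@dof_lift _ _ _ q (dof_is A) _ (a ⊚ pb_p1 E') h) as [z [z1 z2]].
  { symmetry; exact h1. }
  assert (src_z : pi ⊚ (src _ ⊚ z) = pb_p1 Q ⊚ (pb_p1 E ⊚ pb_p1 E')).
  { rewrite z1; rw a1; reflexivity. }
  assert (over_z : F1 Phi ⊚ (F1 q ⊚ z) = pb_p2 Q ⊚ (pb_p1 E ⊚ pb_p1 E')).
  { rewrite z2; exact h3. }
  destruct (@effective_descent_cover _ _ _ _ _ ed _ _ _ _ _ (pb_is_pullback E') B0
    (pi ⊚ (tgt _ ⊚ z))) as [tE [htE _]].
  { intros T u v e; nf; apply target_unique.
    - rw src_z; rw src_z; rewrite e; reflexivity.
    - nf; rw over_z; rw over_z; rewrite e; reflexivity. }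
  assert (tE_lift : forall (T : C) (y : Hom T (pb_obj E)) (w : Hom T (C1 (dof_dom A))),
    pi ⊚ (src _ ⊚ w) = pb_p1 Q ⊚ (pb_p1 E ⊚ y) ->
    F1 Phi ⊚ (F1 q ⊚ w) = pb_p2 Q ⊚ (pb_p1 E ⊚ y) -> tE ⊚ y = pi ⊚ (tgt _ ⊚ w)).
  { intros T y w w1 w2.
    (* The target of [w] supplies the second component of an element of [E'] over [y]. *)
    assert (e : tgt K ⊚ (pb_p2 Q ⊚ pb_p1 E) ⊚ y = F0 Phi ⊚ (F0 q ⊚ (tgt _ ⊚ w))).
    { nf; rewrite <- w2; rw (F_tgt Phi); rw (F_tgt q); reflexivity. }
    rewrite <- (pb_pair_p1 E' e); rw htE; apply target_unique; nf.
    - rw src_z; rw (pb_pair_p1 E' e); symmetry; exact w1.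
    - rw over_z; rw (pb_pair_p1 E' e); symmetry; exact w2. }
  destruct (@effective_descent_cover _ _ _ _ _ ed _ _ _ _ _ (pb_is_pullback E) B0 tE)
    as [t [ht _]].
  (* Elements [u] and [v] over the same arrow of [K] admit a common local lift [w], which computes
     [tE] on both. *)
  { intros T u v e.
    destruct (@local_lift T (pb_p1 Q ⊚ (pb_p1 E ⊚ u)) (pb_p2 Q ⊚ (pb_p1 E ⊚ u)))
      as [T' [c [w [ep [w1 w2]]]]].
    { rw (pb_sq Q); reflexivity. }
    apply ep; rewrite <- !comp_assoc in *.
    rewrite (tE_lift _ (u ⊚ c) w w1 w2); symmetry; apply tE_lift.
    - rewrite w1, (comp_post e); nf; reflexivity.
    - rewrite w2, (comp_post e); nf; reflexivity. }
  exists t; intros T y w w1 w2.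
  assert (e : src K ⊚ pb_p2 Q ⊚ y = F0 Phi ⊚ (F0 q ⊚ (src _ ⊚ w))).
  { nf; rewrite <- w2; rw (F_src Phi); rw (F_src q); reflexivity. }
  pose proof (pb_pair_p1 E e) as e1.
  rewrite <- e1; rw ht; apply tE_lift; rewrite e1; assumption.
Qed.

(** Each law may be verified after an epimorphism, where the points and arrows involved lift to [A]
    and the structure of [A] gives the result. *)
Lemma descended_action (t : Hom (pb_obj Q) B0) : descends t -> is_action t.
Proof.
  intro ht.
  assert (loc : forall (T : C) (y : Hom T (pb_obj Q)),
    exists (T' : C) (c : Hom T' T) (z : Hom T' (C1 (dof_dom A))), epi c /\
      pi ⊚ (src _ ⊚ z) = pb_p1 Q ⊚ (y ⊚ c) /\ F1 Phi ⊚ (F1 q ⊚ z) = pb_p2 Q ⊚ (y ⊚ c)).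
  { intros T y.
    destruct (@local_lift T (pb_p1 Q ⊚ y) (pb_p2 Q ⊚ y)) as [T' [c [z hz]]].
    { rw (pb_sq Q); reflexivity. }
    exists T', c, z; rewrite !comp_assoc; rewrite !comp_assoc in hz; exact hz. }
  constructor; fold Q.
  - destruct (loc _ (idm _)) as [T' [c [z [ep [z1 z2]]]]].
    apply ep; rewrite comp_id_l in z1, z2; nf.
    rewrite (ht _ _ _ z1 z2); rw (proj1 hpi); rewrite <- z2.
    rw (F_tgt Phi); rw (F_tgt q); reflexivity.
  - intros T y hy.
    destruct (local_point (pb_p1 Q ⊚ y) hpi) as [T' [c [a [ep ha]]]].
    apply ep; nf; rewrite (ht _ (y ⊚ c) (unit _ ⊚ a)).
    + rw (tgt_unit (dof_dom A)); rewrite ha; nf; reflexivity.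
    + rw (src_unit (dof_dom A)); rewrite ha; nf; reflexivity.
    + rw hy; rw (F_unit q); rw (F_unit Phi); rwl (proj1 hpi).
      rewrite ha; nf; reflexivity.
  - intros T y1 y2 y3 k k1 k2 e3 e2 e1.
    destruct (loc _ y1) as [T1 [c1 [z1 [ep1 [s1 o1]]]]].
    pose proof (ht _ _ _ s1 o1) as t1.
    (* The second lift has to start at the target of the first, not merely at a point with the same
       image in [B0], for the two to be composable in [A]. *)
    destruct (@local_arrow T1 (tgt _ ⊚ z1) (pb_p2 Q ⊚ (y2 ⊚ c1)))
      as [T2 [c2 [z2 [ep2 [s2 o2]]]]].
    { rwl (pb_sq Q); rw e2; rewrite t1; rw (proj1 hpi); reflexivity. }
    apply (epi_comp ep2 ep1).
    destruct (@composable_lift _ (dof_dom A) _ (z1 ⊚ c2) z2) as [w [w1 w2]].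
    { rewrite s2; nf; reflexivity. }
    nf; rewrite (ht _ (y2 ⊚ (c1 ⊚ c2)) z2), (ht _ (y3 ⊚ (c1 ⊚ c2)) (mult _ ⊚ w)).
    + rw (tgt_mult (dof_dom A)); rewrite w2; reflexivity.
    + rw (src_mult (dof_dom A)); rewrite w1; rw s1; rw e1; reflexivity.
    + rw e3.
      destruct (functor_composable q w) as [w' [w1' w2']].
      destruct (functor_composable Phi w') as [w'' [w1'' w2'']].
      rewrite (functor_mult w1' w2'), (functor_mult w1'' w2'').
      apply f_equal, (pullback_ext (P_pb K)).
      * rewrite w1'', w1', w1; rw o1; rw k1; reflexivity.
      * rewrite w2'', w2', w2, o2; rw k2; reflexivity.
    + rewrite s2; rw e2; rw t1; reflexivity.
    + rewrite o2; nf; reflexivity.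
Qed.

End Local.

(** The opfibration over [K] is the category of elements of the descended action; [descends]
    provides the target condition that extends [pi0] to a functor. *)
Lemma dof_descends (A : DOF H) :
  exists (B : DOF K) (pi : IFun (dof_dom A) (dof_dom B)),
    @is_pullback (CatC C) _ _ _ _ (dof_proj B) Phi pi (dof_proj A).
Proof.
  destruct (descent_object ff A ed) as [B0 [b [pi0 [hpi hvert]]]].
  destruct (descended_target_exists hpi hvert) as [t ht].
  pose (B := action_dof (descended_action hpi ht)).
  destruct (@dof_functor_lift _ _ _ _ (dof_is B) _
    (@comp (CatC C) _ _ _ Phi (dof_proj A)) pi0) as [pi [e0 e]].
  - exact (proj1 hpi).
  - simpl; intros X z w w1 w2; apply ht; [symmetry; exact w1|].
    rewrite comp_assoc; symmetry; exact w2.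
  - exists B, pi; apply dof_pullback_of_F0.
    + exact (dof_is B).
    + exact (dof_is A).
    + exact e.
    + rewrite e0; exact hpi.
Qed.

(** * Pullback along [Phi] as an equivalence *)

Section Equivalence.
Variables (G : Functor (doFib K) (doFib H))
  (pi : forall p : DOF K, IFun (dof_dom (G p)) (dof_dom p)).
Hypothesis hG : is_pullback_functor Phi pi.

Lemma pullback_functor_essentially_surjective : essentially_surjective G.
Proof.
  intro A; destruct (dof_descends A) as [B [r hr]].
  destruct (pullbacks_iso hr (proj1 hG B)) as [i [j [ij [ji [_ [hi [_ hj]]]]]]].
  exists B, (exist _ i hi), (exist _ j hj); split; apply DOF_hom_eq; assumption.
Qed.

(** The projection takes a vertical arrow to one over an identity of [K], where [dof_over_unit]
    applies. *)
Lemma pullback_functor_collapses_vertical (p : DOF K) :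
  collapses_vertical (A := G p) (F0 (pi p)).
Proof.
  intros T z ez; rwl (F_tgt (pi p)); rwl (F_src (pi p)).
  apply (@dof_over_unit _ _ _ _ (dof_is p) _ _ _ (eq_trans
    (comp_post (IFun_eq_F1 (proj1 (proj1 hG p))) z) (eq_trans (eq_sym (comp_assoc _ _ _)) ez))).
Qed.

(** The projection [F0 (pi p)] is a cover whose kernel pair consists of endpoints of vertical
    arrows. A morphism [M] preserves these, so its object part descends; being a cover also gives
    uniqueness. *)
Lemma pullback_functor_fully_faithful : fully_faithful_functor G.
Proof.
  intros p p' M.
  pose proof (pullback_F0 (proj1 hG p)) as hp.
  pose proof (pullback_F0 (proj1 hG p')) as hp'.
  pose proof (IFun_eq_F1 (proj1 (proj1 hG p))) as sq; simpl in sq.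
  pose proof (IFun_eq_F1 (proj1 (proj1 hG p'))) as sq'; simpl in sq'.
  pose proof (effective_descent_cover ed hp) as cov.
  pose proof (cover_epi cov) as ep.
  destruct (cov _ (F0 (pi p') ⊚ F0 (proj1_sig M))) as [m [hm _]].
  { intros T u v e; nf.
    destruct (vertical_lift hp (@pullback_functor_collapses_vertical p) e)
      as [z [<- [<- z3]]].
    rwl (F_tgt (proj1_sig M)); rwl (F_src (proj1_sig M)); symmetry.
    apply pullback_functor_collapses_vertical.
    rw (DOF_hom_F1 M); rw (F_src (proj1_sig M)); rw (DOF_hom_F0 M); exact z3. }
  destruct (@DOF_hom_exists _ _ p p' m) as [F hF].
  { apply ep; rw hm; rw (proj1 hp'); rw (DOF_hom_F0 M); symmetry; exact (proj1 hp). }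
  { intros T z w w1 w2.
    (* Compatibility with targets is local: [z] is lifted to an arrow [y] of [G p], on which [M] is
       already a functor. *)
    destruct (@local_lift (G p) _ _ _ hp T (src _ ⊚ z) (F1 (dof_proj p) ⊚ z))
      as [T' [c [y [epc [y1 y2]]]]].
    { rw (F_src (dof_proj p)); reflexivity. }
    assert (ey : F1 (pi p) ⊚ y = z ⊚ c).
    { apply (dof_ext (dof_is p)).
      - rw (F_src (pi p)); rewrite y1; nf; reflexivity.
      - rw sq; rewrite y2; nf; reflexivity. }
    assert (ew : w ⊚ c = F1 (pi p') ⊚ (F1 (proj1_sig M) ⊚ y)).
    { apply (dof_ext (dof_is p')).
      - rw w1; rw (F_src (pi p')); rw (F_src (proj1_sig M)); rwl hm.
        rewrite y1; nf; reflexivity.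
      - rw w2; rw sq'; rw (DOF_hom_F1 M); rewrite y2; nf; reflexivity. }
    apply epc; nf; rewrite ew, <- ey.
    rw (F_tgt (pi p')); rw (F_tgt (proj1_sig M)); rw (F_tgt (pi p)); rw hm; reflexivity. }
  assert (nat : forall F' : DOF_hom p p', F0 (pi p') ⊚ F0 (proj1_sig (fmap G F')) =
    F0 (proj1_sig F') ⊚ F0 (pi p)).
  { intro F'; exact (IFun_eq_F0 (proj2 hG p p' F')). }
  exists F; split.
  - apply DOF_hom_ext, (pullback_ext hp').
    + rewrite nat, hF; exact hm.
    + rewrite !DOF_hom_F0; reflexivity.
  - intros F' eF'; apply DOF_hom_ext, ep; rewrite <- !nat, eF', nat, hF; exact hm.
Qed.

End Equivalence.
End DescentAlongFunctor.

Theorem theorem5p4 (C : Category) (FC : FinComplete C) (H K : ICat C)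
  (Phi : IFun H K) :
  fully_faithful FC Phi ->
  effective_descent FC (F0 Phi) ->
  pullback_is_equivalence Phi.
Proof.
  intros ff ed; split.
  - exact (pullback_functor_exists FC Phi).
  - intros G pi hG; apply ff_es_equivalence.
    + exact (pullback_functor_fully_faithful ff ed hG).
    + exact (pullback_functor_essentially_surjective ff ed hG).
Qed.
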